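(* Let $d, n, k$ be positive integers with $d \geq 2$ and $2 \leq n \leq d$. Then there exist two $d$-dimensional convex bodies $K, L \subseteq \mathbb{R}^d$ satisfying $K \subseteq L$ and $\mathbb{E} V_{K[n]}^k > \mathbb{E} V_{L[n]}^k$.
   Context: A $d$-dimensional convex body is a compact convex subset of $\mathbb{R}^d$ with nonempty interior. For a $d$-dimensional convex body $K$ and $n \leq d+1$, $V_{K[n]}$ denotes the $(n-1)$-dimensional volume of the convex hull of $n$ independent random points $X_0,\ldots,X_{n-1}$, each uniformly distributed in $K$ (with respect to Lebesgue measure). $\mathbb{E} V_{K[n]}^k$ denotes the $k$-th moment $\mathbb{E}[(V_{K[n]})^k]$. *)

(* Defs.v *)
From HB Require Import structures.
From mathcomp Require Import all_boot all_order all_algebra.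
From mathcomp Require Import all_classical all_reals all_analysis.

Set Implicit Arguments.
Unset Strict Implicit.
Unset Printing Implicit Defensive.
Import Order.TTheory GRing.Theory Num.Theory.
Import numFieldNormedType.Exports.

Local Open Scope classical_set_scope.
Local Open Scope ring_scope.
Local Open Scope ereal_scope.

Section tuple_cons.
Context d (T : measurableType d) (n : nat).

Definition tcons (p : T * n.-tuple T) : n.+1.-tuple T := [tuple of p.1 :: p.2].

Definition tuncons (t : n.+1.-tuple T) : T * n.-tuple T :=
  (thead t, [tuple of behead t]).

Lemma tunconsK : cancel tuncons tcons.
Proof. by move=> t; rewrite [RHS]tuple_eta. Qed.

Lemma tconsK : cancel tcons tuncons.
Proof.
move=> [x t]; rewrite /tuncons/tcons/=; congr pair.
exact: val_inj.
Qed.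

Lemma measurable_tcons : measurable_fun [set: _] tcons.
Proof. exact: (@measurable_cons _ _ _ _ fst _ snd). Qed.

Lemma measurable_tuncons : measurable_fun [set: _] tuncons.
Proof.
apply/measurable_fun_pairP; split; last exact: measurable_behead.
exact: measurable_tnth.
Qed.

End tuple_cons.

(* the n-fold product mu \x (mu \x ...), on the product sigma-algebra of
   n.-tuple T *)
Fixpoint power_measure d (T : measurableType d) (R : realType)
    (mu : set T -> \bar R) (n : nat) : set (n.-tuple T) -> \bar R :=
  match n with
  | 0%N => @dirac _ (0.-tuple T) [tuple] R
  | n'.+1 => pushforward (mu \x @power_measure _ _ _ mu n') (@tcons _ T n')
  end.
Arguments power_measure {d T R} mu n _.

Section power_measure_sigma_finite.
Context d (T : measurableType d) (R : realType).
Variable mu : {sigma_finite_measure set T -> \bar R}.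

Section step.
Variables (n : nat) (nu : {sigma_finite_measure set (n.-tuple T) -> \bar R}).

Definition power_step : set (n.+1.-tuple T) -> \bar R :=
  pushforward (mu \x nu) (@tcons _ T n).

Let mtcons := @measurable_tcons _ T n.

Let step0 : power_step set0 = 0. Proof. exact: measure0. Qed.

Let step_ge0 A : 0 <= power_step A. Proof. exact: measure_ge0. Qed.

Let step_sigma_additive : semi_sigma_additive power_step.
Proof. exact: measure_semi_sigma_additive. Qed.

HB.instance Definition _ := isMeasure.Build _ _ _ power_step
  step0 step_ge0 step_sigma_additive.

Let step_sigma_finite : sigma_finite [set: _] power_step.
Proof.
have /sigma_finiteP[F [TF ndF Foo]] := sigma_finiteT mu.
have /sigma_finiteP[G [TG ndG Goo]] := sigma_finiteT nu.
exists (fun i => @tuncons _ T n @^-1` (F i `*` G i)).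
  rewrite -preimage_bigcup -(@preimage_setT _ _ (@tuncons _ T n)).
  congr (_ @^-1` _); rewrite -setXTT TF TG predeqE => -[x y]; split.
    move=> [/= [i _ Fix] [k _ Gky]]; exists (maxn i k) => //; split.
    - by move: x Fix; exact/subsetPset/ndF/leq_maxl.
    - by move: y Gky; exact/subsetPset/ndG/leq_maxr.
  by move=> [i _ []/= ? ?]; split; exists i.
move=> k; have [? ?] := Foo k; have [? ?] := Goo k; split.
  rewrite -[X in measurable X]setTI; apply: measurable_tuncons => //.
  exact: measurableX.
rewrite /power_step /pushforward -comp_preimage.
rewrite (_ : _ \o _ = id); last by apply/funext => p; exact: tconsK.
by rewrite preimage_id product_measure1E// lte_mul_pinfty// ge0_fin_numE.
Qed.

HB.instance Definition _ := Measure_isSigmaFinite.Build _ _ _ power_step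
  step_sigma_finite.

End step.

Let power_ex n : exists nu : {sigma_finite_measure set (n.-tuple T) -> \bar R},
  power_measure mu n = nu.
Proof.
elim: n => [|n [nu /= ->]]; first by exists (@dirac _ (0.-tuple T) [tuple] R).
by exists (power_step nu).
Qed.

Variable n : nat.

Let power0 : power_measure mu n set0 = 0.
Proof. by have [nu ->] := power_ex n; exact: measure0. Qed.

Let power_ge0 A : 0 <= power_measure mu n A.
Proof. by have [nu ->] := power_ex n; exact: measure_ge0. Qed.

Let power_sigma_additive : semi_sigma_additive (power_measure mu n).
Proof. by have [nu ->] := power_ex n; exact: measure_semi_sigma_additive. Qed.

HB.instance Definition _ := isMeasure.Build _ _ _ (power_measure mu n)
  power0 power_ge0 power_sigma_additive.

Let power_sigma_finite : sigma_finite [set: _] (power_measure mu n).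
Proof. by have [nu ->] := power_ex n; exact: sigma_finiteT. Qed.

HB.instance Definition _ := Measure_isSigmaFinite.Build _ _ _
  (power_measure mu n) power_sigma_finite.

End power_measure_sigma_finite.

Lemma measurable_tuple_box d (T : measurableType d) n (A : 'I_n -> set T) :
  (forall i, measurable (A i)) ->
  measurable [set t : n.-tuple T | forall i, A i (tnth t i)].
Proof.
move=> mA.
rewrite (_ : [set _ | _] =
    \big[setI/setT]_(i < n) ((fun t : n.-tuple T => tnth t i) @^-1` A i)).
  apply: bigsetI_measurable => i _; rewrite -[X in measurable X]setTI.
  exact: measurable_tnth.
by rewrite -bigcap_seq; apply/seteqP; split=> t /= At i => [_|];
  apply: At; rewrite /= mem_index_enum.
Qed.

Lemma power_measure_box d (T : measurableType d) (R : realType)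
    (mu : {sigma_finite_measure set T -> \bar R}) n (A : 'I_n -> set T) :
  (forall i, measurable (A i)) ->
  power_measure mu n [set t | forall i, A i (tnth t i)] = \prod_(i < n) mu (A i).
Proof.
elim: n A => [|n IHn] A mA /=.
  by rewrite big_ord0 diracE mem_set//; case.
rewrite big_ord_recl -IHn; last by move=> i; exact: mA.
rewrite -product_measure1E; [|exact: mA|
  by apply: (@measurable_tuple_box _ _ _ (fun i => A (lift ord0 i))) => i; exact: mA].
rewrite /pushforward; congr (product_measure1 _ _ _).
apply/seteqP; split => -[x t]/=.
  move=> xtA; split => [|i]; first by have := xtA ord0.
  by have := xtA (lift ord0 i); rewrite tnthS.
move=> [Ax At] i; have [j ->|->//] := unliftP ord0 i.
by rewrite tnthS; exact: At.
Qed.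

Section power_measure_probability.
Context d (T : measurableType d) (R : realType) (P : probability T R) (n : nat).

Let power_setT : power_measure P n [set: _] = 1.
Proof.
have := @power_measure_box _ _ _ P n (fun=> [set: T]).
rewrite (_ : [set _ | _] = setT); last by apply/seteqP; split.
move=> -> // ; rewrite big1// => i _; exact: probability_setT.
Qed.

HB.instance Definition _ := Measure_isProbability.Build _ _ _
  (power_measure P n) power_setT.

End power_measure_probability.
Definition rV_display : measure_display -> measure_display.
Proof. exact. Qed.

Section measurable_rV.
Context (R : realType) (d : nat).

Definition rV_coord (i : 'I_d) (v : 'rV[R]_d) : measurableTypeR R := v ord0 i.

Let rV_set0 : g_sigma_preimage rV_coord set0.
Proof. exact: sigma_algebra0. Qed.

Let rV_setC A : g_sigma_preimage rV_coord A -> g_sigma_preimage rV_coord (~` A).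
Proof. exact: sigma_algebraC. Qed.

Let rV_bigcup (F : _^nat) : (forall i, g_sigma_preimage rV_coord (F i)) ->
  g_sigma_preimage rV_coord (\bigcup_i (F i)).
Proof. exact: sigma_algebra_bigcup. Qed.

(* the product sigma-algebra; it contains the open sets (measurable_open_rV), so
   it is the Borel sigma-algebra *)
HB.instance Definition _ := @isMeasurable.Build (rV_display default_measure_display)
  'rV[R]_d (g_sigma_preimage rV_coord) rV_set0 rV_setC rV_bigcup.

Lemma measurable_rV_coord i : measurable_fun [set: 'rV[R]_d] (rV_coord i).
Proof.
move=> _ Y mY; rewrite setTI; apply: sub_sigma_algebra => /=.
rewrite -bigcup_seq/=; exists i => /=; first by rewrite mem_index_enum.
by exists Y => //; rewrite setTI.
Qed.

Definition rV_of_tuple (t : d.-tuple (measurableTypeR R)) : 'rV[R]_d :=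
  \row_i tnth t i.

Lemma measurable_rV_of_tuple : measurable_fun [set: _] rV_of_tuple.
Proof.
move=> _ A mA; rewrite setTI.
have : g_sigma_preimage (fun i => rV_coord i \o rV_of_tuple) (rV_of_tuple @^-1` A).
  by rewrite g_sigma_preimage_comp; exists A => //; rewrite setTI.
congr (g_sigma_preimage _ _).
by apply/funext => i; apply/funext => t /=; rewrite /rV_coord mxE.
Qed.

Lemma measurable_rV_box (A : 'I_d -> set (measurableTypeR R)) :
  (forall i, measurable (A i)) ->
  measurable [set v : 'rV[R]_d | forall i, A i (v ord0 i)].
Proof.
move=> mA; rewrite (_ : [set _ | _] =
    \big[setI/setT]_(i < d) (rV_coord i @^-1` A i)).
  apply: bigsetI_measurable => i _; rewrite -[X in measurable X]setTI.
  exact: measurable_rV_coord.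
by rewrite -bigcap_seq; apply/seteqP; split=> t /= At i => [_|];
  apply: At; rewrite /= mem_index_enum.
Qed.

Lemma measurable_open_rV (U : set 'rV[R]_d) : open U -> measurable U.
Proof.
move=> oU.
pose box (p : 'rV[rat]_d * 'rV[rat]_d) :=
  [set v : 'rV[R]_d | forall i,
     `]ratr (p.1 ord0 i), ratr (p.2 ord0 i)[%classic (v ord0 i : R)].
pose F p := if `[< box p `<=` U >] then box p else set0.
have -> : U = \bigcup_p F p.
  apply/seteqP; split => [v Uv|v [p _]]; last first.
    by rewrite /F; case: asboolP => // + ?; exact.
  have /nbhs_ballP[e /= e0 eU] := open_nbhs_nbhs (conj oU Uv).
  have q1 i : exists q : rat, ratr q \in `](v ord0 i - e)%R, v ord0 i[.
    by apply: rat_in_itvoo; rewrite ltrBlDr ltrDl.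
  have q2 i : exists q : rat, ratr q \in `]v ord0 i, (v ord0 i + e)%R[.
    by apply: rat_in_itvoo; rewrite ltrDl.
  have [f fP] := choice q1.
  have [g gP] := choice q2.
  exists (\row_i f i, \row_i g i) => //.
  rewrite /F; case: asboolP => [_|[]].
    move=> i /=; rewrite !mxE in_itv/=.
    by have := fP i; have := gP i; rewrite !in_itv/= => /andP[-> _] /andP[_ ->].
  move=> w boxw; apply: eU; split => // i j.
  have := boxw j; rewrite /= !mxE in_itv/= (ord1 i) => /andP[fw wg].
  rewrite /ball/= distrC ltr_distl.
  have := fP j; have := gP j; rewrite !in_itv/= => /andP[_ g1] /andP[f1 _].
  by rewrite (lt_trans f1 fw) (lt_trans wg g1).
apply: countable_bigcupT_measurable => [|p]; first exact: (@countableP ('rV[rat]_d * 'rV[rat]_d)%type).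
rewrite /F; case: asboolP => // _; 
apply: (@measurable_rV_box (fun i =>
  `]ratr (p.1 ord0 i), ratr (p.2 ord0 i)[%classic)) => i.
exact: measurable_itv.
Qed.

Definition lebesgue_rV : set 'rV[R]_d -> \bar R :=
  pushforward (power_measure (@lebesgue_measure R) d) rV_of_tuple.

Let mrV := measurable_rV_of_tuple.

Let lebesgue_rV0 : lebesgue_rV set0 = 0. Proof. exact: measure0. Qed.

Let lebesgue_rV_ge0 A : 0 <= lebesgue_rV A. Proof. exact: measure_ge0. Qed.

Let lebesgue_rV_sigma_additive : semi_sigma_additive lebesgue_rV.
Proof. exact: measure_semi_sigma_additive. Qed.

HB.instance Definition _ := isMeasure.Build _ _ _ lebesgue_rV
  lebesgue_rV0 lebesgue_rV_ge0 lebesgue_rV_sigma_additive.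

Lemma lebesgue_rV_box (A : 'I_d -> set (measurableTypeR R)) :
  (forall i, measurable (A i)) ->
  lebesgue_rV [set v | forall i, A i (v ord0 i)] =
  \prod_(i < d) lebesgue_measure (A i).
Proof.
move=> mA; rewrite -power_measure_box// /lebesgue_rV /pushforward.
congr (power_measure _ _ _).
by apply/seteqP; split => t /= At i; have := At i; rewrite mxE.
Qed.

End measurable_rV.

Record convex_body (R : realType) (d : nat) := ConvexBody {
  body :> set 'rV[R]_d ;
  body_compact : compact body ;
  body_convex : convex_set body ;
  body_interior : body^° !=set0 }.

Section uniform_distribution.
Context (R : realType) (d : nat) (K : convex_body R d).

Lemma measurable_body : measurable (K : set 'rV[R]_d).
Proof.
have cK : closed (K : set 'rV[R]_d).
  by apply: compact_closed; [exact: norm_hausdorff|exact: body_compact].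
rewrite -[X in measurable X]setCK; apply: measurableC.
by apply: measurable_open_rV; rewrite openC.
Qed.

Lemma lebesgue_body_gt0 : 0 < lebesgue_rV K.
Proof.
have [v /nbhs_ballP[e /= e0 veK]] := @body_interior _ _ K.
pose A i : set (measurableTypeR R) := `](v ord0 i - e)%R, (v ord0 i + e)%R[%classic.
have mA i : measurable (A i) by exact: measurable_itv.
apply: (@lt_le_trans _ _ (lebesgue_rV [set v | forall i, A i (v ord0 i)])).
  rewrite lebesgue_rV_box//; elim/big_ind : _ => // [x y|i _]; first exact: mule_gt0.
  rewrite lebesgue_measure_itv/= lte_fin ifT ?lte_fin ?subr_gt0//.
    by rewrite ltrBlDr -addrA ltrDl addr_gt0.
  by rewrite ltrBlDr -addrA ltrDl addr_gt0.
apply: le_measure; rewrite ?inE; [exact: measurable_rV_box|exact: measurable_body|].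
move=> w Aw; apply: veK; split => // i j; rewrite (ord1 i).
by have := Aw j; rewrite /A/= in_itv/= /ball/= distrC ltr_distl.
Qed.

Lemma lebesgue_body_lty : lebesgue_rV K < +oo.
Proof.
have [M [_ /(_ (M + 1)%R) KM]] := compact_bounded (@body_compact _ _ K).
pose A (i : 'I_d) : set (measurableTypeR R) := `[(- (M + 1))%R, (M + 1)%R]%classic.
have mA i : measurable (A i) by exact: measurable_itv.
apply: (@le_lt_trans _ _ (lebesgue_rV [set v | forall i, A i (v ord0 i)])).
  apply: le_measure; rewrite ?inE; [exact: measurable_body|exact: measurable_rV_box|].
  move=> v Kv i; rewrite /A/= in_itv/= -ler_norml.
  have /= := KM _ v Kv; rewrite ltrDl ltr01 => /(_ isT).
  apply: le_trans; rewrite [leRHS]/Num.norm/= mx_normrE.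
  by apply/bigmax_geP; right => /=; exists (ord0, i).
rewrite lebesgue_rV_box//.
rewrite -ge0_fin_numE; last by apply: prode_ge0 => i _; exact: measure_ge0.
apply: prode_fin_num => i _; rewrite /A lebesgue_measure_itv/=.
by case: ifP.
Qed.

(* the fallback measure \d_0 is not used, as 0 < lebesgue_rV K < +oo:
   see uniform_bodyE *)
Definition uniform_body : set 'rV[R]_d -> \bar R :=
  mnormalize (mrestr (@lebesgue_rV R d) measurable_body)
             (@dirac _ 'rV[R]_d 0%R R).

HB.instance Definition _ := Probability.on uniform_body.

Lemma uniform_bodyE (A : set 'rV[R]_d) :
  uniform_body A = lebesgue_rV (A `&` K) * ((fine (lebesgue_rV K))^-1)%:E.
Proof.
rewrite /uniform_body /mnormalize /= /mrestr setTI.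
by rewrite (gt_eqF lebesgue_body_gt0) (lt_eqF lebesgue_body_lty).
Qed.

End uniform_distribution.

Definition convex_hull (R : realType) (d : nat) (A : set 'rV[R]_d) :
  set 'rV[R]_d := smallest (@convex_set R 'rV[R]_d) A.

Section volume.
Context (R : realType) (d : nat).

(* Isometric parametrization of the m-flat through p directed by the rows of Q,
   when these are orthonormal. *)
Definition flat_param m (p : 'rV[R]_d) (Q : 'M[R]_(m, d)) (y : 'rV[R]_m) :
  'rV[R]_d := (p + y *m Q)%R.

(* m-dimensional volume of a subset A of an m-flat of R^d: the Lebesgue measure
   of A read in orthonormal coordinates of such a flat. By isometry invariance
   all the values under the supremum are equal, so the supremum only avoids
   choosing a flat and coordinates; it is -oo if no m-flat contains A. *)
Definition flat_volume m (A : set 'rV[R]_d) : \bar R :=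
  ereal_sup [set lebesgue_rV (flat_param pQ.1 pQ.2 @^-1` A) |
    pQ in [set pQ : 'rV[R]_d * 'M[R]_(m, d) |
      pQ.2 *m pQ.2^T = 1%:M /\ A `<=` range (flat_param pQ.1 pQ.2)]].

(* (n-1)-dimensional volume of the convex hull of the points x_0, ..., x_{n-1}.
   When 1 <= n <= d+1, n points always lie in an (n-1)-flat, so [fine] is applied to a finite value. *)
Definition simplex_volume n (x : n.-tuple 'rV[R]_d) : R :=
  fine (flat_volume n.-1 (convex_hull [set` x])).

(* E V_{K[n]}^k: the points are the coordinates of a sample of the n-fold product
   of the uniform distribution, hence independent and uniform in K. *)
Definition volume_moment (K : convex_body R d) (n k : nat) : \bar R :=
  'E_(power_measure (uniform_body K) n)[fun x => (simplex_volume x ^+ k)%R].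

End volume.

(* Main.v *)
(* Let the last coordinates of a body shrink to zero: when n <= d the random
   simplex collapses onto the first n - 1 "main" coordinates, and the moment
   tends, up to a fixed factor, to the mean of |det|^k, where det is the
   determinant formed by the edges of the projected simplex. So it is enough to
   find K c= L for which this limit mean is strictly larger on K.

   Let y be a coordinate that collapses and t a main one. K is the box
   0 <= y <= 1, all other coordinates in [-1, 1]; L is the box 0 <= y <= 3/2
   cut by |t| + y <= 2. The slice of L at height y is the slice of K with t
   scaled by w(y) = min(1, 2 - y). Hence a uniform point of L is obtained from a
   height y drawn from L and an independent uniform point of K by multiplying t
   by w(y). As det is linear in the t-coordinates t_1, ..., t_n of the n points
   and the t_i are symmetric, replacing each t_i by w_i t_i multiplies the mean
   of |det|^k by at most (max w_i)^k (contraction principle: average over signs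
   and use convexity). Finally all the w_i are at most 3/4 with positive
   probability, so the mean on L is strictly smaller. *)

Require Import Defs.
From HB Require Import structures.
From mathcomp Require Import all_boot all_order all_algebra.
From mathcomp Require Import all_classical all_reals all_analysis.
From mathcomp Require Import perm measurable_realfun ring lra.

Import Order.TTheory GRing.Theory Num.Theory.
Import numFieldNormedType.Exports.

Set Implicit Arguments.
Unset Strict Implicit.
Unset Printing Implicit Defensive.

Local Open Scope classical_set_scope.
Local Open Scope ring_scope.

(** * Integration over power measures *)

Section integral_power_measure.
Local Open Scope ereal_scope.
Context {R : realType}.

(** The limit of the flattenings is a singular map, so the limit of the moments is not the moment of
    a convex body. Hence the volume of a simplex with edge matrix [E] is expressed by the Gram
    determinant of [E *m W *m E^T], which is polynomial in [W] and makes sense for singular [W].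
    Flattening thereby acts on the integrand and not on the body, and dominated convergence applies
    over one fixed probability space. The condition n <= d leaves a coordinate outside the limit
    determinant. The height has to be this one: with the heights fixed, the factors w_i are
    constants, and neither the cofactors nor the t_i depend on them. The density of the height in L
    is proportional to [width], the Jacobian of the slice map, so drawing the height from L itself
    accounts for this Jacobian and leaves the other coordinates uniform on one cube. For the
    contraction, the law of K is invariant under each reflection t_i -> -t_i; summing over all sign
    patterns under the integral gives an inequality that holds pointwise. Strictness also needs the
    limit mean on K to be finite and positive. *)

Lemma integral_power0 d (T : measurableType d)
    (mu : {sigma_finite_measure set T -> \bar R}) (F : 0.-tuple T -> \bar R) :
  measurable_fun [set: 0.-tuple T] F -> \int[power_measure mu 0]_t F t = F [tuple].
Proof. by move=> mF; rewrite integral_dirac// diracT mul1e. Qed.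

Lemma integral_power_cons d (T : measurableType d)
    (mu : {sigma_finite_measure set T -> \bar R}) n
    (F : n.+1.-tuple T -> \bar R) :
  measurable_fun [set: _] F -> (forall t, 0 <= F t) ->
  \int[power_measure mu n.+1]_t F t =
  \int[mu]_x \int[power_measure mu n]_t F (tcons (x, t)).
Proof.
move=> mF F0.
rewrite [LHS](_ : _ = \int[pushforward (mu \x power_measure mu n)
  (@tcons _ T n)]_t F t)//.
rewrite ge0_integral_pushforward//; last exact: measurable_tcons.
rewrite preimage_setT fubini_tonelli1//; last by move=> z; exact: F0.
by apply: measurableT_comp => //; exact: measurable_tcons.
Qed.

Lemma measurable_integral_power_cons d (T : measurableType d)
    (mu : {sigma_finite_measure set T -> \bar R}) n
    (F : n.+1.-tuple T -> \bar R) :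
  measurable_fun [set: _] F -> (forall t, 0 <= F t) ->
  measurable_fun [set: T] (fun x => \int[power_measure mu n]_t F (tcons (x, t))).
Proof.
move=> mF F0.
apply: (measurable_fun_fubini_tonelli_F (F \o @tcons _ T n)) => [|z]; last exact: F0.
by apply: measurableT_comp => //; exact: measurable_tcons.
Qed.

Lemma measurable_tuple_of d1 (T1 : measurableType d1) d2 (T2 : measurableType d2)
    n (f : 'I_n -> T1 -> T2) :
  (forall i, measurable_fun [set: T1] (f i)) ->
  measurable_fun [set: T1] (fun x => [tuple f i x | i < n]).
Proof.
move=> mf; apply/measurable_fun_tnthP => i.
by apply: eq_measurable_fun (mf i) => x _; rewrite /= tnth_mktuple.
Qed.

Lemma mktuple_cons (A B : Type) n (f : 'I_n.+1 -> A -> B) (x : A) (t : n.-tuple A) :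
  [tuple f i (tnth [tuple of x :: t] i) | i < n.+1] =
  [tuple of f ord0 x :: [tuple f (lift ord0 i) (tnth t i) | i < n]].
Proof.
apply: eq_from_tnth => i; rewrite tnth_mktuple.
by have [j ->|->//] := unliftP ord0 i; rewrite !tnthS tnth_mktuple.
Qed.

(** Says that a product of image laws is the image of the product law; being an image law is phrased
    through integrals of nonnegative functions. The map may vary with the index because each vertex
    later receives its own sign. *)
Lemma integral_power_map d1 (T1 : measurableType d1) d2 (T2 : measurableType d2)
    (mu1 : {sigma_finite_measure set T1 -> \bar R})
    (mu2 : {sigma_finite_measure set T2 -> \bar R}) n (f : 'I_n -> T1 -> T2) :
  (forall i, measurable_fun [set: T1] (f i)) ->
  (forall i g, measurable_fun [set: T2] g -> (forall y, 0 <= g y) ->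
    \int[mu2]_y g y = \int[mu1]_x g (f i x)) ->
  forall F, measurable_fun [set: _] F -> (forall t, 0 <= F t) ->
  \int[power_measure mu2 n]_t F t =
  \int[power_measure mu1 n]_t F [tuple f i (tnth t i) | i < n].
Proof.
elim: n f => [f _ _ F mF F0|n IHn f mf fE F mF F0].
  rewrite !integral_power0//; last first.
    apply: measurableT_comp => //.
    by apply: measurable_tuple_of => -[].
  by congr F; rewrite [RHS]tuple0.
have mmap (k : nat) (h : 'I_k -> T1 -> T2) : (forall i, measurable_fun [set: T1] (h i)) ->
    measurable_fun [set: k.-tuple T1] (fun t => [tuple h i (tnth t i) | i < k]).
  move=> mh; apply: (@measurable_tuple_of _ _ _ _ _ (fun i t => h i (tnth t i))) => i.
  by apply: measurableT_comp => //; exact: measurable_tnth.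
have mFm := measurableT_comp mF (mmap _ _ mf).
rewrite !integral_power_cons//.
rewrite (fE ord0)//; last 2 first.
- exact: measurable_integral_power_cons.
- by move=> y; exact: integral_ge0.
apply: eq_integral => x _.
rewrite (IHn (fun i => f (lift ord0 i)))//; last 2 first.
- by move=> i g mg g0; exact: fE.
- by apply: (measurableT_comp mF); apply: measurable_cons => //; exact: measurable_id.
apply: eq_integral => t _; congr F.
by rewrite /tcons/= mktuple_cons.
Qed.

(** If [psi] applied to independent points of laws [P1] and [P2] has law [P3], then [n] independent
    such pairs give a sample of [n] points of law [P3]. Regrouping the pairs into two samples is a
    repeated use of Tonelli. *)
Lemma integral_power_couple d1 (T1 : measurableType d1) d2 (T2 : measurableType d2)
    d3 (T3 : measurableType d3)
    (P1 : {sigma_finite_measure set T1 -> \bar R})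
    (P2 : {sigma_finite_measure set T2 -> \bar R})
    (P3 : {sigma_finite_measure set T3 -> \bar R})
    (psi : T1 * T2 -> T3) n :
  measurable_fun [set: _] psi ->
  (forall g, measurable_fun [set: T3] g -> (forall y, 0 <= g y) ->
    \int[P3]_y g y = \int[P1]_u \int[P2]_v g (psi (u, v))) ->
  forall F, measurable_fun [set: _] F -> (forall t, 0 <= F t) ->
  \int[power_measure P3 n]_t F t =
  \int[power_measure P1 n]_u \int[power_measure P2 n]_v
    F [tuple psi (tnth u i, tnth v i) | i < n].
Proof.
move=> mpsi psiE.
have mz k : measurable_fun [set: k.-tuple T1 * k.-tuple T2]
    (fun uv => [tuple psi (tnth uv.1 i, tnth uv.2 i) | i < k]).
  apply: (@measurable_tuple_of _ _ _ _ _
    (fun i (uv : k.-tuple T1 * k.-tuple T2) => psi (tnth uv.1 i, tnth uv.2 i))) => i.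
  apply: measurableT_comp => //; apply: measurable_fun_pair.
    exact: (measurableT_comp (measurable_tnth i) measurable_fst).
  exact: (measurableT_comp (measurable_tnth i) measurable_snd).
elim: n => [F mF F0|n IHn F mF F0].
  rewrite [LHS]integral_power0//.
  transitivity (\int[power_measure P1 0]_u cst (F [tuple]) u).
    by rewrite integral_power0.
  apply: eq_integral => u _; rewrite integral_power0.
    by congr F; rewrite [RHS]tuple0.
  apply: (measurableT_comp mF).
  by apply: measurable_tuple_of => -[].
have mF2 := measurableT_comp mF (mz n.+1).
pose G u v := F [tuple psi (tnth u i, tnth v i) | i < n.+1].
have mG : measurable_fun [set: _] (fun u => \int[power_measure P2 n.+1]_v G u v).
  by apply: (measurable_fun_fubini_tonelli_F
    (fun uv : n.+1.-tuple T1 * n.+1.-tuple T2 => G uv.1 uv.2)) => // z; exact: F0.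
rewrite [RHS]integral_power_cons//; last first.
  by move=> t; apply: integral_ge0 => v _; exact: F0.
rewrite integral_power_cons//.
rewrite psiE//; last 2 first.
- exact: measurable_integral_power_cons.
- by move=> y; exact: integral_ge0.
apply: eq_integral => u0 _.
transitivity (\int[power_measure P1 n]_u \int[P2]_v0 \int[power_measure P2 n]_v
    G (tcons (u0, u)) (tcons (v0, v))); last first.
  apply: eq_integral => u _; rewrite [RHS]integral_power_cons//.
  exact: (measurableT_comp mF2 (pair1_measurable (tcons (u0, u)))).
have Gc u v0 v : G (tcons (u0, u)) (tcons (v0, v)) =
    F (tcons (psi (u0, v0), [tuple psi (tnth u i, tnth v i) | i < n])).
  rewrite /G; congr F; apply: eq_from_tnth => i; rewrite tnth_mktuple /tcons/=.
  by have [j ->|->//] := unliftP ord0 i; rewrite !tnthS tnth_mktuple.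
have mH : measurable_fun [set: (T2 * n.-tuple T1) * n.-tuple T2] (fun z =>
    F (tcons (psi (u0, z.1.1), [tuple psi (tnth z.1.2 i, tnth z.2 i) | i < n]))).
  apply: (measurableT_comp mF).
  apply: (measurableT_comp (@measurable_tcons _ T3 n)).
  apply: measurable_fun_pair => /=.
    apply: measurableT_comp => //; apply: measurable_fun_pair => //.
    exact: (measurableT_comp measurable_fst measurable_fst).
  apply: (@measurable_tuple_of _ _ _ _ _
    (fun i (z : (T2 * n.-tuple T1) * n.-tuple T2) => psi (tnth z.1.2 i, tnth z.2 i))) => i.
  apply: measurableT_comp => //; apply: measurable_fun_pair.
    apply: (measurableT_comp (measurable_tnth i)).
    exact: (measurableT_comp measurable_snd measurable_fst).
  by apply: (measurableT_comp (measurable_tnth i)).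
(* The right side integrates the whole of [u] before [v], while the induction hypothesis needs the
   pair of first points outermost: [v0] is moved in front of the tail of [u]. *)
have -> : \int[power_measure P1 n]_u \int[P2]_v0 \int[power_measure P2 n]_v
    G (tcons (u0, u)) (tcons (v0, v)) =
    \int[P2]_v0 \int[power_measure P1 n]_u \int[power_measure P2 n]_v
    F (tcons (psi (u0, v0), [tuple psi (tnth u i, tnth v i) | i < n])).
  under eq_integral do under eq_integral do under eq_integral do rewrite Gc.
  apply/esym; apply: (fubini_tonelli (fun z : T2 * n.-tuple T1 => \int[power_measure P2 n]_v
    F (tcons (psi (u0, z.1), [tuple psi (tnth z.2 i, tnth v i) | i < n])))) => /=.
    by apply: (measurable_fun_fubini_tonelli_F
      (fun z : (T2 * n.-tuple T1) * n.-tuple T2 =>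
      F (tcons (psi (u0, z.1.1), [tuple psi (tnth z.1.2 i, tnth z.2 i) | i < n])))).
  by move=> z; apply: integral_ge0.
apply: eq_integral => v0 _; rewrite -(IHn (fun t => F (tcons (psi (u0, v0), t))))//.
by apply: (measurableT_comp mF); apply: measurable_cons => //; exact: measurable_id.
Qed.

End integral_power_measure.

(** * Lebesgue measure under linear maps *)

Section lebesgue_affine.
Local Open Scope ereal_scope.
Context {R : realType}.
Local Notation leb := (@lebesgue_measure R).

Lemma measurable_affine (a b : R) :
  measurable_fun [set: measurableTypeR R] (fun x : measurableTypeR R => (a * x + b)%R :
      measurableTypeR R).
Proof.
by apply: measurable_funD => //; apply: measurable_funM => //.
Qed.

(** By uniqueness of Lebesgue measure it suffices to compare lengths of intervals []u, v]]. For
    negative [a] the preimage is closed on the left and open on the right, hence the two cases. *)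
Lemma ge0_integral_affine (a b : R) (g : R -> \bar R) : a != 0%R ->
  measurable_fun [set: measurableTypeR R] g -> (forall x, 0 <= g x) ->
  \int[leb]_x g x = (`|a|%R)%:E * \int[leb]_x g (a * x + b)%R.
Proof.
move=> a0 mg g0.
pose phi (x : measurableTypeR R) : measurableTypeR R := (a * x + b)%R.
have mphi : measurable_fun setT phi := measurable_affine a b.
pose k : {nonneg R} := NngNum (normr_ge0 a).
have [nu nuE] : exists nu : {measure set (measurableTypeR R) -> \bar R},
    nu = pushforward leb phi :> (set _ -> _).
  by unshelve eexists (pushforward leb phi).
have -> : \int[leb]_x g x = \int[mscale k nu]_x g x.
  apply: eq_measure_integral => A mA _; apply: lebesgue_measure_unique => //.
  move=> _ [[u v] _ <-] /=.
  rewrite /mscale/= nuE /pushforward lebesgue_measure_itv/=.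
  case: (ltgtP a 0%R) => [a_lt0|a_gt0|a_eq0]; last by rewrite a_eq0 eqxx in a0.
  - have -> : phi @^-1` `]u, v]%classic = `[((v - b) / a)%R, ((u - b) / a)%R[%classic.
      apply/seteqP; split => x /=; rewrite !in_itv/= ler_ndivrMr// ltr_ndivlMr//;
        by rewrite lerBrDr ltrBlDr andbC (mulrC x).
    rewrite lebesgue_measure_itv/= !lte_fin ltr_nM2r ?invr_lt0// ltrD2r.
    case: ifPn => uv; last by rewrite mule0.
    rewrite -EFinM ltr0_norm//; congr EFin; by field; exact: a0.
  - have -> : phi @^-1` `]u, v]%classic = `]((u - b) / a)%R, ((v - b) / a)%R]%classic.
      apply/seteqP; split => x /=; rewrite !in_itv/= ltr_pdivrMr// ler_pdivlMr//;
        by rewrite lerBrDr ltrBlDr (mulrC x).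
    rewrite lebesgue_measure_itv/= !lte_fin ltr_pM2r ?invr_gt0// ltrD2r.
    case: ifPn => uv; last by rewrite mule0.
    rewrite -EFinM gtr0_norm//; congr EFin; by field; exact: a0.
rewrite ge0_integral_mscale//= nuE ge0_integral_pushforward//.
Qed.

End lebesgue_affine.

Section rV_integral.
Local Open Scope ereal_scope.
Context {R : realType}.
Local Notation leb := (@lebesgue_measure R).

Lemma measurable_fun_rV d (T : measurableType d) m (f : T -> 'rV[R]_m) :
  (forall i, measurable_fun [set: T] (fun t => f t ord0 i : measurableTypeR R)) ->
  measurable_fun [set: T] f.
Proof.
move=> mf _ A mA; rewrite setTI.
have : g_sigma_preimage (fun i => @rV_coord R m i \o f) (f @^-1` A).
  by rewrite g_sigma_preimage_comp; exists A => //; rewrite setTI.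
apply: smallest_sub; first exact: sigma_algebra_measurable.
rewrite -bigcup_seq => B [i _ [C mC <-]]; exact: mf.
Qed.

Lemma measurable_rV_entry m (i : 'I_m) :
  measurable_fun [set: 'rV[R]_m] (fun v => v ord0 i : measurableTypeR R).
Proof. exact: measurable_rV_coord. Qed.

(** Built with [row_mx] so that block matrices of size [1 + m] act on it by [mul_row_block]. *)
Definition rV_cons m (p : measurableTypeR R * 'rV[R]_m) : 'rV[R]_m.+1 :=
  row_mx (p.1)%:M p.2.

Lemma rV_cons0 m p : @rV_cons m p ord0 ord0 = p.1.
Proof.
transitivity (row_mx p.1%:M p.2 ord0 (lshift m (ord0 : 'I_1))).
  by congr (row_mx _ _ _ _); exact: val_inj.
by rewrite row_mxEl mxE eqxx mulr1n.
Qed.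

Lemma rV_consS m p (j : 'I_m) : @rV_cons m p ord0 (lift ord0 j) = p.2 ord0 j.
Proof.
transitivity (row_mx p.1%:M p.2 ord0 (rshift 1 j)).
  by congr (row_mx _ _ _ _); exact: val_inj.
by rewrite row_mxEr.
Qed.

Lemma measurable_rV_cons m : measurable_fun [set: _] (@rV_cons m).
Proof.
apply: measurable_fun_rV => i; have [j ->|->] := unliftP ord0 i.
  under eq_fun do rewrite rV_consS.
  exact: (measurableT_comp (@measurable_rV_entry m j) measurable_snd).
under eq_fun do rewrite rV_cons0.
exact: measurable_fst.
Qed.

Lemma integral_rV_tuple m (g : 'rV[R]_m -> \bar R) :
  measurable_fun [set: _] g -> (forall v, 0 <= g v) ->
  \int[@lebesgue_rV R m]_v g v = \int[power_measure leb m]_t g (rV_of_tuple t).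
Proof.
move=> mg g0; rewrite /lebesgue_rV ge0_integral_pushforward//.
exact: measurable_rV_of_tuple.
Qed.

Lemma rV_of_tuple_cons m (x : measurableTypeR R) (t : m.-tuple (measurableTypeR R)) :
  rV_of_tuple (tcons (x, t)) = rV_cons (x, rV_of_tuple t).
Proof.
apply/rowP => i; have [j ->|->] := unliftP ord0 i.
  by rewrite rV_consS !mxE /= tnthS.
by rewrite rV_cons0 mxE.
Qed.

Lemma integral_rV_cons m (g : 'rV[R]_m.+1 -> \bar R) :
  measurable_fun [set: _] g -> (forall v, 0 <= g v) ->
  \int[@lebesgue_rV R m.+1]_v g v =
  \int[leb]_x \int[@lebesgue_rV R m]_y g (rV_cons (x, y)).
Proof.
move=> mg g0; rewrite integral_rV_tuple// integral_power_cons//; last first.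
  by apply: (measurableT_comp mg); exact: measurable_rV_of_tuple.
apply: eq_integral => x _; rewrite integral_rV_tuple//; last first.
  apply: (measurableT_comp mg).
  exact: (measurableT_comp (measurable_rV_cons (m:=m)) (pair1_measurable x)).
by apply: eq_integral => t _; rewrite rV_of_tuple_cons.
Qed.

(* fubini_tonelli does not apply as such: lebesgue_rV has no sigma-finite
   instance, unlike power_measure. *)
Lemma rV_fubini_tonelli m (h : measurableTypeR R * 'rV[R]_m -> \bar R) :
  measurable_fun [set: _] h -> (forall z, 0 <= h z) ->
  \int[leb]_x \int[@lebesgue_rV R m]_y h (x, y) =
  \int[@lebesgue_rV R m]_y \int[leb]_x h (x, y).
Proof.
move=> mh h0.
have mT := @measurable_rV_of_tuple R m.
rewrite [RHS]integral_rV_tuple//; last 2 first.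
- exact: measurable_fun_fubini_tonelli_G.
- by move=> v; exact: integral_ge0.
transitivity (\int[leb]_x \int[power_measure leb m]_t h (x, rV_of_tuple t)).
  apply: eq_integral => x _; rewrite integral_rV_tuple//.
  exact: (measurableT_comp mh (pair1_measurable x)).
apply: (fubini_tonelli (fun z => h (z.1, rV_of_tuple z.2))) => [|z]; last exact: h0.
apply: (measurableT_comp mh); apply: measurable_fun_pair => //.
exact: (measurableT_comp mT).
Qed.

Lemma measurable_integral_rV_cons d (T : measurableType d) m (h : T * 'rV[R]_m -> \bar R) :
  measurable_fun [set: _] h -> (forall z, 0 <= h z) ->
  measurable_fun [set: T] (fun x => \int[@lebesgue_rV R m]_y h (x, y)).
Proof.
move=> mh h0.
have mT := @measurable_rV_of_tuple R m.
rewrite (_ : (fun x => _) = fun x => \int[power_measure leb m]_t h (x, rV_of_tuple t)).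
  apply: (measurable_fun_fubini_tonelli_F (fun z => h (z.1, rV_of_tuple z.2))) => [|z];
      last exact: h0.
  apply: (measurableT_comp mh); apply: measurable_fun_pair => //.
  exact: (measurableT_comp mT).
apply/funext => x; rewrite integral_rV_tuple//.
exact: (measurableT_comp mh (pair1_measurable x)).
Qed.

End rV_integral.

Section linear_change_of_variables.
Local Open Scope ereal_scope.
Context {R : realType}.
Local Notation leb := (@lebesgue_measure R).
Local Notation lam := (@lebesgue_rV R _).

Lemma measurable_rV_mul m p (M : 'M[R]_(m, p)) :
  measurable_fun [set: 'rV[R]_m] (fun v => v *m M)%R.
Proof.
apply: measurable_fun_rV => j; under eq_fun do rewrite mxE.
apply: measurable_sum => i; apply: measurable_funM => //.
exact: measurable_rV_entry.
Qed.

Lemma measurable_rV_add m : measurable_fun [set: 'rV[R]_m * 'rV[R]_m] (fun p => p.1 +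
    p.2)%R.
Proof.
apply: measurable_fun_rV => j; under eq_fun do rewrite mxE.
apply: measurable_funD.
  exact: (measurableT_comp (measurable_rV_entry j) measurable_fst).
exact: (measurableT_comp (measurable_rV_entry j) measurable_snd).
Qed.

Lemma measurable_rV_shift m (c : 'rV[R]_m) :
  measurable_fun [set: 'rV[R]_m] (fun v => v + c)%R.
Proof.
exact: (measurableT_comp (@measurable_rV_add m) (pair2_measurable c)).
Qed.

Lemma measurable_comp_cons m (g : 'rV[R]_m.+1 -> \bar R) (x : measurableTypeR R) :
  measurable_fun [set: _] g -> measurable_fun [set: _] (fun y => g (rV_cons (x, y))).
Proof.
move=> mg; apply: (measurableT_comp mg).
exact: (measurableT_comp (@measurable_rV_cons _ m) (pair1_measurable x)).
Qed.

Lemma integral_lebesgue_shift (c : R) (g : R -> \bar R) :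
  measurable_fun [set: measurableTypeR R] g -> (forall x, 0 <= g x) ->
  \int[leb]_x g (x + c)%R = \int[leb]_x g x.
Proof.
move=> mg g0; rewrite [RHS](@ge0_integral_affine _ 1%R c)//.
by rewrite normr1 mul1e; apply: eq_integral => x _; rewrite mul1r.
Qed.

Lemma integral_rV_shift m (c : 'rV[R]_m) (g : 'rV[R]_m -> \bar R) :
  measurable_fun [set: _] g -> (forall v, 0 <= g v) ->
  \int[lam]_v g (v + c)%R = \int[lam]_v g v.
Proof.
elim: m c g => [c g _ _|m IHm c g mg g0].
  by apply: eq_integral => v _; congr g; apply/rowP => -[].
rewrite !integral_rV_cons//; last first.
  exact: (measurableT_comp mg (measurable_rV_shift c)).
rewrite -[RHS](@integral_lebesgue_shift (c ord0 ord0))//; last 2 first.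
- apply: (measurable_integral_rV_cons (h := g \o @rV_cons R m)) => [|z]; last exact: g0.
  exact: (measurableT_comp mg (@measurable_rV_cons _ _)).
- by move=> x; exact: integral_ge0.
apply: eq_integral => x _.
rewrite -[RHS](IHm (\row_j c ord0 (lift ord0 j)))//; last first.
  exact: measurable_comp_cons.
apply: eq_integral => y _; congr g; apply/rowP => i.
by rewrite mxE; have [j ->|->] := unliftP ord0 i; rewrite ?rV_consS ?rV_cons0 ?mxE.
Qed.

(** Taken as a property of the matrix because it is stable under products, which reduces it to block
    triangular factors. *)
Definition change_var m (M : 'M[R]_m) := forall g : 'rV[R]_m -> \bar R,
  measurable_fun [set: _] g -> (forall v, 0 <= g v) ->
  \int[lam]_v g v = (`|\det M|%R)%:E * \int[lam]_v g (v *m M)%R.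

Lemma change_varM m (M N : 'M[R]_m) :
  change_var M -> change_var N -> change_var (M *m N).
Proof.
move=> cM cN g mg g0; rewrite cN// cM//; last first.
  exact: (measurableT_comp mg (measurable_rV_mul N)).
rewrite muleA -EFinM -normrM det_mulmx (mulrC (\det N)).
by congr (_ * _); apply: eq_integral => v _; rewrite mulmxA.
Qed.

(** The map is (x, y) -> (a x, x u + y N). For fixed x the inner integral is a change of variables
    by [N] followed by a translation; the outer one is a rescaling of the line. *)
Lemma change_var_ublock m (a : R) (u : 'rV[R]_m) (N : 'M[R]_m) :
  a != 0%R -> change_var N ->
  change_var (block_mx a%:M u 0 N : 'M[R]_(1 + m)).
Proof.
move=> a0 cN g mg g0; set M := block_mx _ _ _ _.
have mgM := measurableT_comp mg (measurable_rV_mul M).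
rewrite (det_ublock (a%:M : 'M[R]_1) u N) det_scalar1 normrM EFinM -muleA.
rewrite integral_rV_cons// (@integral_rV_cons _ m) => [|//|v]; last exact: g0.
rewrite (@ge0_integral_affine _ a 0%R)//; last 2 first.
- apply: (measurable_integral_rV_cons (h := g \o @rV_cons R m)) => [|z]; last exact: g0.
  exact: (measurableT_comp mg (@measurable_rV_cons _ _)).
- by move=> x; exact: integral_ge0.
congr (_ * _); rewrite -ge0_integralZl//; last 2 first.
- apply: (measurable_integral_rV_cons (h := fun z => g ((rV_cons z : 'rV[R]_(1 + m)) *m
    M)%R)) => [|z]; last exact: g0.
  exact: (measurableT_comp mgM (@measurable_rV_cons _ _)).
- by move=> x _; exact: integral_ge0.
apply: eq_integral => x _; rewrite addr0.
rewrite -[LHS](integral_rV_shift (x *: u)%R)//; last exact: measurable_comp_cons.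
rewrite (cN (fun y => g (rV_cons ((a * x)%R, (y + x *: u)%R))))//; last first.
  exact: (measurableT_comp (measurable_comp_cons _ mg) (measurable_rV_shift _)).
congr (_ * _); apply: eq_integral => y _; congr g.
rewrite /rV_cons/= mul_row_block mulmx0 addr0 -scalar_mxM mulrC; congr row_mx.
by rewrite mul_scalar_mx addrC.
Qed.

(** The map is the shear (x, y) -> (x + y w, y). Integrating in x first turns it into a translation
    of the line, which is why both sides are swapped by Tonelli. *)
Lemma change_var_lblock m (w : 'cV[R]_m) :
  change_var (block_mx 1%:M 0 w 1%:M : 'M[R]_(1 + m)).
Proof.
move=> g mg g0.
rewrite (det_lblock (1%:M : 'M[R]_1) w 1%:M) !det1 mulr1 normr1 mul1e.
have mgM := measurableT_comp mg (measurable_rV_mul (block_mx 1%:M 0 w 1%:M : 'M[R]_(1 +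
    m))).
rewrite integral_rV_cons// (@integral_rV_cons _ m) => [|//|v]; last exact: g0.
rewrite (rV_fubini_tonelli (h := g \o @rV_cons R m)) => [||z]; last exact: g0; last first.
  exact: (measurableT_comp mg (@measurable_rV_cons _ _)).
rewrite (rV_fubini_tonelli (h := fun z => g ((rV_cons z : 'rV[R]_(1 + m)) *m block_mx
    1%:M 0 w 1%:M)%R)) => [||z]; last exact: g0; last first.
  exact: (measurableT_comp mgM (@measurable_rV_cons _ _)).
apply: eq_integral => y _.
rewrite -[LHS](@integral_lebesgue_shift ((y *m w) ord0 ord0)%R)//; last 2 first.
- exact: (measurableT_comp (measurableT_comp mg (@measurable_rV_cons _ _))
    (pair2_measurable y)).
- by move=> x; exact: g0.
apply: eq_integral => x _ /=; congr g.
rewrite /rV_cons/= mul_row_block mulmx0 add0r !mulmx1 raddfD/=; congr row_mx.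
by congr (_ + _)%R; exact/esym/mx11_scalar.
Qed.

(* Gaussian elimination: after adding a row to make the (0, 0) entry nonzero, M
   is a product of block triangular matrices covered by the induction. *)
Lemma change_var_unit m (M : 'M[R]_m) : M \in unitmx -> change_var M.
Proof.
elim: m M => [M _ g _ _|m IHm M].
  rewrite det_mx00 normr1 mul1e; apply: eq_integral => v _; congr g.
  by apply/rowP => -[].
have pivot (A : 'M[R]_(1 + m)) : A \in unitmx -> A ord0 ord0 != 0%R -> change_var A.
  move=> uA a0; set a := A ord0 ord0 in a0.
  have ulE : ulsubmx A = a%:M.
    by apply/matrixP => i j; rewrite !ord1 !mxE eqxx mulr1n; congr (A _ _); exact: val_inj.
  (* The Schur complement of the pivot [a]. *)
  pose N := (drsubmx A - a^-1 *: (dlsubmx A *m ursubmx A))%R.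
  have AE : A = block_mx 1%:M 0 (a^-1 *: dlsubmx A) 1%:M *m block_mx a%:M (ursubmx A) 0 N.
    rewrite mulmx_block !mul1mx !mul0mx ?mulmx0 !addr0 mul_mx_scalar scalerA mulfV//
        scale1r.
    by rewrite -scalemxAl /N addrC subrK -ulE submxK.
  have uN : N \in unitmx.
    move: uA; rewrite !unitmxE AE det_mulmx det_lblock !det1 !mul1r det_ublock det_scalar1.
    by rewrite unitrM => /andP[].
  rewrite AE; apply: change_varM; first exact: change_var_lblock.
  by apply: change_var_ublock => //; exact: IHm.
move=> uM.
have [M0|M0] := eqVneq (M ord0 ord0) 0%R; last exact: pivot.
have [i Mi] : exists i, M i ord0 != 0%R.
  apply/existsP; apply: contraLR uM => /existsPn M0'.
  rewrite unitmxE unitfE negbK (expand_det_col _ ord0) big1// => i _.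
  by have := M0' i; rewrite negbK => /eqP ->; rewrite mul0r.
have [j ij|i0] := unliftP ord0 i; last by rewrite i0 M0 eqxx in Mi.
pose E s : 'M[R]_(1 + m) := block_mx 1%:M (s *: delta_mx ord0 j) 0 1%:M.
have uE s : E s \in unitmx by rewrite unitmxE det_ublock !det1 mulr1 unitr1.
have -> : M = E (-1)%R *m (E 1%R *m M).
  rewrite mulmxA (_ : E _ *m E _ = 1%:M) ?mul1mx//.
  rewrite mulmx_block !mul1mx !mul0mx ?mulmx0 !addr0 !add0r mulmx1.
  by rewrite scaleN1r scale1r subrr -scalar_mx_block.
apply: change_varM.
  apply: change_var_ublock; first exact: oner_neq0.
  by apply: IHm; rewrite unitmx1.
apply: pivot; first by rewrite unitmx_mul uE.
have l0 : lshift m ord0 = ord0 :> 'I_(1 + m) by exact: val_inj.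
have E0 k : E 1%R ord0 (rshift 1 k) = ((k == j)%:R)%R.
  by rewrite /E -[in LHS]l0 block_mxEur !mxE mul1r.
rewrite mxE big_split_ord/= big_ord1 l0 M0 mulr0 add0r (bigD1 j)//= big1.
  rewrite E0 eqxx mul1r addr0.
  by rewrite (_ : rshift 1 j = i)// ij; exact: val_inj.
by move=> k kj; rewrite E0 (negbTE kj) mul0r.
Qed.

End linear_change_of_variables.

(** * Convex hulls and the volume of simplices *)

Section convex_hull_points.
Context {R : realType}.

Lemma cvg_sum_R (T : Type) (F : set_system T) (I : Type) (r : seq I)
    {FF : Filter F} (f : I -> T -> R) (a : I -> R) :
  (forall i, f i x @[x --> F] --> a i) ->
  (\sum_(i <- r) f i x) @[x --> F] --> \sum_(i <- r) a i.
Proof.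
by move=> fa; apply: cvg_big => //; exact: add_continuous.
Qed.

Lemma cvg_prod_R (T : Type) (F : set_system T) (I : Type) (r : seq I)
    {FF : Filter F} (f : I -> T -> R) (a : I -> R) :
  (forall i, f i x @[x --> F] --> a i) ->
  (\prod_(i <- r) f i x) @[x --> F] --> \prod_(i <- r) a i.
Proof.
by move=> fa; apply: cvg_big => //; exact: mul_continuous.
Qed.

Lemma continuous_rV_mul m p (M : 'M[R]_(m, p)) :
  continuous (fun v : 'rV[R]_m => v *m M).
Proof.
move=> v; apply/(@cvgrPdist_le _ _ _ (nbhs v)) => e e0.
have H j : \forall w \near v, `|(v *m M) ord0 j - (w *m M) ord0 j| <= e.
  have : (w *m M) ord0 j @[w --> v] --> (v *m M) ord0 j.
    rewrite mxE; under eq_fun do rewrite mxE.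
    by apply: (@cvg_sum_R _ (nbhs v)) => i; apply: cvgM; [
        exact: coord_continuous|exact: cvg_cst].
  by move/(@cvgrPdist_le _ _ _ (nbhs v))/(_ _ e0).
have HH : \forall w \near v, forall j, `|(v *m M) ord0 j - (w *m M) ord0 j| <= e.
  exact: (@filter_forall _ _ _ (nbhs v)).
apply: (@filterS _ (nbhs v) _ _ _ _ HH) => w Hw.
rewrite /Num.Def.normr/= mx_normrE (bigmax_le _ (ltW e0))//= => -[i j] _ /=.
by rewrite (ord1 i) !mxE/=; have := Hw j; rewrite !mxE.
Qed.

Lemma convex_setP m (A : set 'rV[R]_m) : convex_set A <->
  (forall x y (t : R), A x -> A y -> 0 <= t -> t <= 1 ->
    A (t *: x + (1 - t) *: y)).
Proof.
split => [cA x y t Ax Ay t0 t1|cA x y l /set_mem Ax /set_mem Ay]; last first.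
  by rewrite inE; apply: cA.
by have := cA x y (Itv01 t0 t1) (mem_set Ax) (mem_set Ay); rewrite inE.
Qed.

Lemma convex_combination m n (A : set 'rV[R]_m) (w : 'I_n -> R) (x : 'I_n -> 'rV[R]_m) :
  convex_set A -> (forall i, 0 <= w i) -> \sum_i w i = 1 ->
  (forall i, A (x i)) -> A (\sum_i w i *: x i).
Proof.
move/convex_setP => cA; elim: n w x => [w x _|n IHn w x w0 w1 Ax].
  by rewrite big_ord0 => /eqP; rewrite eq_sym oner_eq0.
rewrite big_ord_recl.
(* The remaining weights are renormalised by [1 - w ord0]; when this vanishes they are all zero. *)
have [w01|w01] := eqVneq (w ord0) 1.
  move: w1; rewrite big_ord_recl w01 => /eqP; rewrite -subr_eq0 addrC addKr => w1.
  rewrite big1 ?addr0 ?scale1r// => i _.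
  have /eqP -> : w (lift ord0 i) == 0.
    by move: w1; rewrite psumr_eq0// => /allP/(_ i); rewrite mem_index_enum; exact.
  by rewrite scale0r.
have sw : \sum_(i < n) w (lift ord0 i) = 1 - w ord0.
  by rewrite -w1 big_ord_recl addrC addKr.
have w_lt1 : 0 < 1 - w ord0.
  by rewrite lt_neqAle eq_sym subr_eq0 eq_sym w01/= -sw sumr_ge0.
have -> : \sum_(i < n) w (lift ord0 i) *: x (lift ord0 i) =
    (1 - w ord0) *: \sum_(i < n) (w (lift ord0 i) / (1 - w ord0)) *: x (lift ord0 i).
  rewrite scaler_sumr; apply: eq_bigr => i _; rewrite scalerA; congr (_ *: _).
  by rewrite mulrC divfK// gt_eqF.
apply: cA => //; last by rewrite -subr_ge0 ltW.
apply: IHn => [i||i]; [by rewrite divr_ge0// ltW| |exact: Ax].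
by rewrite -mulr_suml sw divff// gt_eqF.
Qed.

Definition simplex_weights n : set 'rV[R]_n :=
  [set w | (forall i, 0 <= w ord0 i) /\ \sum_i w ord0 i = 1].

Definition points_mx m n (x : n.-tuple 'rV[R]_m) : 'M[R]_(n, m) :=
  \matrix_i tnth x i.

Lemma mul_points_mx m n (x : n.-tuple 'rV[R]_m) (w : 'rV[R]_n) :
  w *m points_mx x = \sum_i w ord0 i *: tnth x i.
Proof. by rewrite mulmx_sum_row; apply: eq_bigr => i _; rewrite rowK. Qed.

Lemma convex_simplex_image m n (M : 'M[R]_(n, m)) :
  convex_set ((fun w => w *m M) @` @simplex_weights n).
Proof.
apply/convex_setP => _ _ t [w [w0 w1] <-] [w' [w'0 w'1] <-] t0 t1.
exists (t *: w + (1 - t) *: w'); last by rewrite mulmxDl !scalemxAl.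
split => [i|].
  by rewrite !mxE addr_ge0 ?mulr_ge0// subr_ge0.
under eq_bigr do rewrite !mxE.
by rewrite big_split/= -!mulr_sumr w1 w'1 !mulr1 addrC subrK.
Qed.

(** Presenting the hull as a linear image of the standard simplex gives its compactness and its
    behaviour under affine charts. *)
Lemma convex_hullE m n (x : n.-tuple 'rV[R]_m) :
  convex_hull [set` x] = (fun w => w *m points_mx x) @` @simplex_weights n.
Proof.
apply/seteqP; split; last first.
  move=> _ [w [w0 w1] <-] A [cA xA]; rewrite mul_points_mx.
  by apply: convex_combination => // i; apply: xA; rewrite /= mem_tnth.
apply: smallest_sub; first exact: convex_simplex_image.
move=> v /= /tnthP[i ->]; exists (delta_mx ord0 i).
  split => [j|]; first by rewrite mxE; case: eqP.
  by rewrite (bigD1 i)//= big1 ?addr0 ?mxE ?eqxx// => j ji; rewrite mxE (negbTE ji) andbF.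
by rewrite -rowE rowK.
Qed.

Lemma compact_simplex_weights n : compact (@simplex_weights n).
Proof.
apply: bounded_closed_compact.
  exists 1; split => // M M1 w [w0 w1] /=.
  rewrite [leLHS]/Num.Def.normr/= mx_normrE (bigmax_le _ (le_trans ler01 (ltW M1)))//=
      => -[i j] _.
  rewrite (ord1 i)/= ger0_norm//; apply: le_trans (ltW M1).
  by rewrite -w1 (bigD1 j)//= lerDl sumr_ge0.
have -> : @simplex_weights n =
    (\bigcap_(i : 'I_n) ((fun w : 'rV[R]_n => w ord0 i) @^-1` [set r | 0 <= r])) `&`
    ((fun w : 'rV[R]_n => \sum_i w ord0 i) @^-1` [set 1]).
  by apply/seteqP; split => w /= [w0 w1]; split => // i; [move=> _|]; exact: w0.
apply: closedI.
  apply: closed_bigI => i _; apply: preimage_closed; last exact: closed_ge.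
  by move=> v _; exact: coord_continuous.
apply: preimage_closed; last exact: closed_eq.
by move=> v _; apply: (@cvg_sum_R _ (nbhs v)) => i; exact: coord_continuous.
Qed.

Lemma compact_convex_hull m n (x : n.-tuple 'rV[R]_m) :
  compact (convex_hull [set` x]).
Proof.
rewrite convex_hullE; apply: continuous_compact; last exact: compact_simplex_weights.
by apply: continuous_subspaceT; exact: continuous_rV_mul.
Qed.

Lemma measurable_compact_rV m (A : set 'rV[R]_m) : compact A -> measurable A.
Proof.
move=> cA; rewrite -[A]setCK; apply: measurableC; apply: measurable_open_rV.
by rewrite openC; apply: compact_closed => //; exact: norm_hausdorff.
Qed.

End convex_hull_points.

Section orthonormal_frame.
Context {R : realType}.

Lemma mulmx_tr_ge0 m (z : 'rV[R]_m) : 0 <= (z *m z^T) ord0 ord0.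
Proof. by rewrite mxE sumr_ge0// => i _; rewrite mxE -expr2 sqr_ge0. Qed.

Lemma mulmx_tr_eq0 m (z : 'rV[R]_m) : ((z *m z^T) ord0 ord0 == 0) = (z == 0).
Proof.
apply/idP/eqP => [|->]; last by rewrite mul0mx mxE.
rewrite mxE psumr_eq0 => [/allP z0|i _]; last by rewrite mxE -expr2 sqr_ge0.
apply/rowP => i; have := z0 i; rewrite mem_index_enum => /(_ isT).
by rewrite !mxE -expr2 sqrf_eq0 => /eqP.
Qed.

(** Gram-Schmidt on the rows. Dependent rows are allowed: if the first row lies in the span of [Q],
    the new direction is any nonzero vector of the kernel of [Q^T], which exists since the rank of
    [Q] is less than [d], and it enters with coefficient zero. *)
Lemma orthonormal_frame d m (D : 'M[R]_(m, d)) : (m <= d)%N ->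
  exists Q : 'M[R]_(m, d), exists Y : 'M[R]_m, Q *m Q^T = 1%:M /\ D = Y *m Q.
Proof.
elim: m D => [D _|m IHm D md].
  by exists 0, 0; split; apply/matrixP => -[].
have [Q [Y [QQ DE]]] := IHm (dsubmx (D : 'M[R]_(1 + m, d))) (ltnW md).
set a := usubmx (D : 'M[R]_(1 + m, d)) .
pose r := a - a *m Q^T *m Q.
have rQ : r *m Q^T = 0 by rewrite mulmxBl -!mulmxA QQ mulmx1 subrr.
have [z [s [z0 zQ rE]]] : exists z s, [/\ z != 0, z *m Q^T = 0 & r = s *: z].
  have [r0|r0] := eqVneq r 0; last by exists r, 1; rewrite scale1r.
  exists (nz_row (kermx Q^T)), 0; split; last by rewrite scale0r.
    rewrite nz_row_eq0 kermx_eq0 /row_free mxrank_tr neq_ltn.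
    by rewrite (leq_ltn_trans (rank_leq_row Q) md).
  by apply/sub_kermxP; exact: nz_row_sub.
pose nu := Num.sqrt ((z *m z^T) ord0 ord0).
have nu0 : nu != 0.
  by rewrite gt_eqF// sqrtr_gt0 lt_neqAle eq_sym mulmx_tr_eq0 z0 mulmx_tr_ge0.
pose q := nu^-1 *: z.
have qq : q *m q^T = 1%:M.
  rewrite [LHS]mx11_scalar; congr _%:M.
  rewrite /q linearZ/= -scalemxAl -scalemxAr scalerA mxE.
  by rewrite -(sqr_sqrtr (mulmx_tr_ge0 z)) -/nu expr2 mulrA mulfVK// mulVf.
have qQ : q *m Q^T = 0 by rewrite /q -scalemxAl zQ scaler0.
have QE : col_mx q Q *m (col_mx q Q)^T = 1%:M :> 'M[R]_(1 + m).
  rewrite tr_col_mx mul_col_row qq qQ QQ (_ : Q *m q^T = 0) -?scalar_mx_block//.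
  by apply: trmx_inj; rewrite trmx_mul trmxK qQ trmx0.
have DYQ : block_mx (s * nu)%:M (a *m Q^T) 0 Y *m col_mx q Q = D :> 'M[R]_(1 + m, d).
  rewrite mul_block_col mul0mx add0r -DE mul_scalar_mx scalerA mulfK// -rE.
  by rewrite /r subrK vsubmxK.
by exists (col_mx q Q), (block_mx (s * nu)%:M (a *m Q^T) 0 Y).
Qed.

End orthonormal_frame.

Section simplex_volume.
Context {R : realType}.

Definition edges_mx d m (x : m.+1.-tuple 'rV[R]_d) : 'M[R]_(m, d) :=
  \matrix_(i < m) (tnth x (lift ord0 i) - tnth x ord0).

Definition unit_simplex_vertices m : m.+1.-tuple 'rV[R]_m :=
  [tuple if unlift ord0 i is Some j then delta_mx ord0 j else 0 | i < m.+1].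

Lemma weights_affine d m n (x : n.-tuple 'rV[R]_d) (y : n.-tuple 'rV[R]_m) p Q w :
  (forall i, tnth x i = flat_param p Q (tnth y i)) -> simplex_weights w ->
  w *m points_mx x = flat_param p Q (w *m points_mx y).
Proof.
move=> xE [_ w1]; rewrite /flat_param !mul_points_mx mulmx_suml -[p in RHS]scale1r -w1.
rewrite scaler_suml -big_split/=; apply: eq_bigr => i _.
by rewrite xE /flat_param scalerDr scalemxAl.
Qed.

Lemma preimage_convex_hull d m n (x : n.-tuple 'rV[R]_d) (y : n.-tuple 'rV[R]_m) p Q :
  injective (flat_param p Q) ->
  (forall i, tnth x i = flat_param p Q (tnth y i)) ->
  flat_param p Q @^-1` convex_hull [set` x] = convex_hull [set` y].
Proof.
move=> inj xE; rewrite !convex_hullE; apply/seteqP; split => z [w ww] /=.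
  by rewrite (weights_affine xE ww) => /inj <-; exists w.
by move=> <-; exists w => //; exact: weights_affine.
Qed.

Lemma weights_unit_simplex m (w : 'rV[R]_m.+1) :
  w *m points_mx (unit_simplex_vertices m) = \row_j w ord0 (lift ord0 j).
Proof.
rewrite mul_points_mx big_ord_recl tnth_mktuple unlift_none scaler0 add0r.
under eq_bigr do rewrite tnth_mktuple liftK.
apply/rowP => j; rewrite summxE !mxE (bigD1 j)//= !mxE !eqxx mulr1 big1 ?addr0// => i ij.
by rewrite !mxE eqxx eq_sym (negbTE ij) mulr0.
Qed.

Lemma interior_unit_simplex m :
  (convex_hull [set` unit_simplex_vertices m])° !=set0.
Proof.
(* In the ball of radius [c] around the constant vector [c] the coordinates lie between 0 and 2c,
   and their sum is at most 2cm = m / (m + 1). *)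
pose c : R := (2 * m.+1%:R)^-1.
have c0 : 0 < c by rewrite invr_gt0 mulr_gt0.
exists (const_mx c); apply/nbhs_ballP; exists c => //= v [_ cv].
have v0 i : 0 <= v ord0 i.
  have := cv ord0 i; rewrite mxE /ball/= ltr_norml => /andP[_ h].
  lra.
have vc i : v ord0 i <= c * 2.
  have := cv ord0 i; rewrite mxE /ball/= ltr_norml => /andP[h _].
  lra.
have sv : \sum_i v ord0 i <= 1.
  apply: (@le_trans _ _ (\sum_(i < m) c * 2)); first exact: ler_sum.
  rewrite sumr_const card_ord -[leLHS]mulr_natr.
  rewrite (_ : c * 2 * m%:R = m%:R / m.+1%:R).
    by rewrite ler_pdivrMr// mul1r ler_nat.
  have : (m.+1%:R : R) != 0 by rewrite pnatr_eq0.
  by rewrite /c; move: (m.+1%:R : R) => N N0; field.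
rewrite convex_hullE; exists (rV_cons (1 - \sum_i v ord0 i, v)).
  split => [i|].
    by have [j ->|->] := unliftP ord0 i; rewrite ?rV_consS ?rV_cons0// subr_ge0.
  rewrite big_ord_recl rV_cons0 [X in _ + X](eq_bigr (fun i => v ord0 i)) => [|i _].
    by rewrite /= subrK.
  by rewrite rV_consS.
by rewrite weights_unit_simplex; apply/rowP => j; rewrite mxE rV_consS.
Qed.

Lemma convex_convex_hull d (A : set 'rV[R]_d) : convex_set (convex_hull A).
Proof.
move=> x y l /set_mem xA /set_mem yA; rewrite inE => B [cB AB].
by have := cB x y l; rewrite !inE; apply; [exact: xA|exact: yA].
Qed.

Definition unit_simplex m : convex_body R m :=
  ConvexBody (@compact_convex_hull _ _ _ (unit_simplex_vertices m))
    (@convex_convex_hull _ _) (interior_unit_simplex m).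

(** The constant 1 / m!. It is a common positive factor of the moments to be compared, so its value
    does not matter. *)
Definition unit_simplex_volume m : R := fine (lebesgue_rV (unit_simplex m)).

Lemma unit_simplex_volume_gt0 m : 0 < unit_simplex_volume m.
Proof. by rewrite fine_gt0// lebesgue_body_gt0 lebesgue_body_lty. Qed.

Lemma unit_simplex_volumeE m :
  lebesgue_rV (unit_simplex m) = (unit_simplex_volume m)%:E.
Proof.
by rewrite fineK// ge0_fin_numE ?lebesgue_body_lty// ltW// lebesgue_body_gt0.
Qed.

Lemma lebesgue_rV_preimage m (M : 'M[R]_m) (p : 'rV[R]_m) (A : set 'rV[R]_m) :
  M \in unitmx -> measurable A ->
  lebesgue_rV A = (`|\det M|%:E * lebesgue_rV (flat_param p M @^-1` A))%E.
Proof.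
move=> uM mA.
have mf : measurable_fun [set: 'rV[R]_m] (flat_param p M).
  rewrite (_ : flat_param p M = (fun v => v + p) \o (fun v => v *m M)).
    exact: (measurableT_comp (measurable_rV_shift p) (measurable_rV_mul M)).
  by apply/funext => v; rewrite /flat_param/= addrC.
have mB : measurable (flat_param p M @^-1` A) by rewrite -[X in measurable X]setTI;
    exact: mf.
have mi (B : set 'rV[R]_m) : measurable B ->
    measurable_fun [set: 'rV[R]_m] (fun v => (\1_B v)%:E : \bar R).
  by move=> mB'; apply/measurable_EFinP; exact: measurable_indic.
rewrite -[A in LHS]setIT -integral_indic// -(integral_rV_shift p); last 2 first.
- exact: mi.
- by move=> v; rewrite lee_fin.
rewrite (change_var_unit uM); last 2 first.
- exact: (measurableT_comp (mi _ mA) (measurable_rV_shift p)).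
- by move=> v; rewrite lee_fin.
rewrite -[X in lebesgue_rV X]setIT -integral_indic//; congr (_ * _)%E.
by apply: eq_integral => v _; rewrite /flat_param addrC.
Qed.

Lemma measurable_hyperplane m (u : 'rV[R]_m) (b : R) :
  measurable [set z : 'rV[R]_m | (z *m u^T) ord0 ord0 = b].
Proof.
rewrite -[X in measurable X]setTI.
have mf := measurableT_comp (@measurable_rV_entry R 1 ord0) (measurable_rV_mul u^T).
by apply: (mf measurableT [set b]); exact: measurable_set1.
Qed.

(** Completing [u] to a basis gives linear coordinates in which the hyperplane is a box with one
    side reduced to the point [b / c]. *)
Lemma lebesgue_rV_hyperplane m (u : 'rV[R]_m) (b : R) : u != 0 ->
  lebesgue_rV [set z : 'rV[R]_m | (z *m u^T) ord0 ord0 = b] = 0%E.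
Proof.
case: m u => [u|m u u0]; first by rewrite (thinmx0 u) eqxx.
have ru : \rank u = 1%N by apply/eqP; rewrite eqn_leq rank_leq_row lt0n mxrank_eq0.
pose B := row_ebase u.
have uB : B \in unitmx by exact: row_ebase_unit.
pose c := col_ebase u ord0 ord0.
have uE : u = c *: row ord0 B.
  rewrite -[LHS]mulmx_ebase ru [col_ebase u]mx11_scalar mul_scalar_mx -scalemxAl.
  congr (_ *: _); apply/rowP => j; rewrite mxE (bigD1 ord0)//= !mxE/= mul1r.
  rewrite big1 ?addr0// => i i0; rewrite mxE.
  by have /negbTE : (i : nat) != 0%N := i0; rewrite eq_sym => ->; rewrite mul0r.
have c0 : c != 0 by apply: contraNneq u0 => c0; rewrite uE c0 scale0r.
pose N := invmx B^T.
have uN : N \in unitmx by rewrite unitmx_inv unitmx_tr.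
have mH : measurable [set z : 'rV[R]_m.+1 | (z *m u^T) ord0 ord0 = b].
  exact: measurable_hyperplane.
rewrite (lebesgue_rV_preimage 0 uN mH).
have -> : flat_param 0 N @^-1` [set z : 'rV[R]_m.+1 | (z *m u^T) ord0 ord0 = b] =
   [set z | forall i : 'I_m.+1, (if i == ord0 then [set b / c] else setT) (z ord0 i)].
  have zE z : (flat_param 0 N z *m u^T) ord0 ord0 = c * z ord0 ord0.
    rewrite /flat_param add0r uE linearZ/= -scalemxAr mxE; congr (_ * _).
    by rewrite tr_row colE -mulmxA (mulmxA N) mulVmx ?unitmx_tr// mul1mx -colE mxE.
  apply/seteqP; split => z /=; rewrite zE.
    by move=> <- i; case: eqP => // ->; rewrite /= mulrC mulKf.
  by move=> /(_ ord0) /= ->; rewrite mulrC divfK.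
rewrite (@lebesgue_rV_box R m.+1 (fun i => if i == ord0 then [set b / c] else setT)) =>
    [|i]; last by case: ifP => _; [exact: measurable_set1|exact: measurableT].
by rewrite big_ord_recl/= lebesgue_measure_set1 mul0e mule0.
Qed.

(* When the edges are dependent the hull lies in a hyperplane, and both sides
   vanish. *)
Lemma lebesgue_rV_convex_hull m (y : m.+1.-tuple 'rV[R]_m) :
  lebesgue_rV (convex_hull [set` y]) =
  (unit_simplex_volume m * `|\det (edges_mx y)|)%:E.
Proof.
have mH := measurable_compact_rV (@compact_convex_hull _ _ _ y).
have [detM|detM] := eqVneq (\det (edges_mx y)) 0; last first.
  have uM : edges_mx y \in unitmx by rewrite unitmxE unitfE.
  rewrite (lebesgue_rV_preimage (tnth y ord0) uM mH) mulrC EFinM -unit_simplex_volumeE.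
  congr (_ * lebesgue_rV _)%E; apply: preimage_convex_hull.
    by move=> v w /addrI /(can_inj (mulmxK uM)).
  move=> i; rewrite /flat_param tnth_mktuple.
  have [j ->|->] := unliftP ord0 i; last by rewrite mul0mx addr0.
  by rewrite -rowE rowK addrC subrK.
rewrite detM normr0 mulr0.
have /det0P[v v0 vM] : \det (edges_mx y)^T == 0 by rewrite det_tr detM.
have {}vM : edges_mx y *m v^T = 0 by apply: trmx_inj; rewrite trmx_mul trmxK vM trmx0.
pose b := (tnth y ord0 *m v^T) ord0 ord0.
apply/eqP; rewrite eq_le measure_ge0 andbT -[leRHS](lebesgue_rV_hyperplane b v0).
apply: le_measure; rewrite ?inE//.
  exact: measurable_hyperplane.
rewrite convex_hullE => _ [w [_ w1] <-] /=.
rewrite mul_points_mx mulmx_suml summxE -[RHS]mul1r -w1 mulr_suml; apply: eq_bigr => i _.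
rewrite -scalemxAl mxE; congr (_ * _).
have [j ->|->//] := unliftP ord0 i.
have /rowP/(_ ord0) := congr1 (row j) vM.
rewrite row_mul rowK mulmxBl row0 !mxE => /eqP; rewrite subr_eq0 => /eqP.
by rewrite /b !mxE.
Qed.

(** In a chart with orthonormal rows [Q] the edges are [Y *m Q], so their Gram matrix is [Y *m Y^T]
    and the root of its determinant is the absolute value of the determinant of [Y]. All charts thus
    give the same value, and [orthonormal_frame] provides one: the supremum runs over a
    singleton. *)
Lemma simplex_volumeE d m (x : m.+1.-tuple 'rV[R]_d) : (m <= d)%N ->
  simplex_volume x =
  unit_simplex_volume m * Num.sqrt (\det (edges_mx x *m (edges_mx x)^T)).
Proof.
move=> md; rewrite /simplex_volume/= /flat_volume.
set V := (RHS); set S := [set _ | _ in _].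
have SV v : S v -> v = V%:E.
  move=> [[p Q] /= [QQ hullQ] <-].
  have inj : injective (flat_param p Q).
    by move=> z z' /addrI /(congr1 (mulmx^~ Q^T)); rewrite /= -!mulmxA QQ !mulmx1.
  have xQ i : exists y, tnth x i = flat_param p Q y.
    have [|y _ yE] := hullQ (tnth x i); last by exists y.
    by move=> A [_]; apply; exact: mem_tnth.
  have [f fE] := choice xQ.
  pose y := [tuple f i | i < m.+1].
  have xE i : tnth x i = flat_param p Q (tnth y i) by rewrite tnth_mktuple.
  rewrite (preimage_convex_hull inj xE) lebesgue_rV_convex_hull; congr (_ * _)%:E.
  have -> : edges_mx x = edges_mx y *m Q.
    apply/row_matrixP => i; rewrite row_mul !rowK !xE /flat_param mulmxBl.
    by rewrite opprD addrACA subrr add0r.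
  by rewrite trmx_mul -mulmxA (mulmxA Q) QQ mul1mx det_mulmx det_tr -expr2 sqrtr_sqr.
have [v Sv] : S !=set0.
  have [Q [Y [QQ YE]]] := orthonormal_frame (edges_mx x) md.
  eexists; exists (tnth x ord0, Q) => //=; split => //.
  rewrite convex_hullE => _ [w ww <-].
  pose y : m.+1.-tuple 'rV[R]_m :=
    [tuple if unlift ord0 i is Some j then row j Y else 0 | i < m.+1].
  exists (w *m points_mx y) => //; apply/esym; apply: weights_affine => // i.
  rewrite tnth_mktuple /flat_param; have [j ->|->] := unliftP ord0 i.
    by rewrite -row_mul -YE rowK addrC subrK.
  by rewrite mul0mx addr0.
have -> : S = [set V%:E].
  apply/seteqP; split => [u /SV ->//|u ->].
  by rewrite -(SV _ Sv).
by rewrite ereal_sup1.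
Qed.

End simplex_volume.

(** * Moments of flattened bodies *)

Section uniform_integral.
Local Open Scope ereal_scope.
Context {R : realType} {d : nat}.

Lemma integral_uniform_body (K : convex_body R d) (g : 'rV[R]_d -> \bar R) :
  measurable_fun [set: _] g -> (forall v, 0 <= g v) ->
  \int[uniform_body K]_v g v =
  ((fine (lebesgue_rV K))^-1)%:E * \int[@lebesgue_rV R d]_v (g v * (\1_K v)%:E).
Proof.
move=> mg g0; have mK := measurable_body K.
have k0 : (0 <= (fine (lebesgue_rV K))^-1)%R.
  by rewrite invr_ge0 fine_ge0// measure_ge0.
rewrite [LHS](@ge0_negligible_integral _ _ _ _ setT (~` K))//; last 2 first.
- by apply: measurableC.
- by rewrite [LHS]uniform_bodyE setICl measure0 mul0e.
rewrite setTD setCK.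
rewrite (@eq_measure_integral _ _ _ _ (mscale (NngNum k0) (@lebesgue_rV R d))) =>
    [|A mA AK].
  rewrite ge0_integral_mscale//=; last exact: measurable_funTS.
  by rewrite integral_mkcond epatch_indic.
by rewrite [LHS]uniform_bodyE setIidl// muleC.
Qed.

Section linear_image.
Variables (K : convex_body R d) (M : 'M[R]_d) (uM : M \in unitmx).

Let image_compact : compact ((mulmx^~ M) @` K).
Proof.
apply: continuous_compact; last exact: body_compact.
by apply: continuous_subspaceT; exact: continuous_rV_mul.
Qed.

Let image_convex : convex_set ((mulmx^~ M) @` K).
Proof.
apply/convex_setP => _ _ t [x Kx <-] [y Ky <-] t0 t1.
have /convex_setP cK := @body_convex _ _ K.
by exists (t *: x + (1 - t) *: y)%R; [exact: cK|rewrite mulmxDl !scalemxAl].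
Qed.

Let image_interior : ((mulmx^~ M) @` K)° !=set0.
Proof.
have [v Kv] := @body_interior _ _ K; exists (v *m M).
have KE : ((mulmx^~ M) @` K) = (mulmx^~ (invmx M)) @^-1` K.
  apply/seteqP; split => [_ [x Kx <-]|x Kx] /=; first by rewrite mulmxK.
  by exists (x *m invmx M) => //; rewrite mulmxKV.
rewrite KE; apply: (@continuous_rV_mul _ _ _ (invmx M)).
by rewrite mulmxK.
Qed.

Definition linear_image : convex_body R d :=
  ConvexBody image_compact image_convex image_interior.

(** The Jacobian of [M] cancels against the change of the total volume. *)
Lemma integral_uniform_linear_image (g : 'rV[R]_d -> \bar R) :
  measurable_fun [set: _] g -> (forall v, 0 <= g v) ->
  \int[uniform_body linear_image]_v g v = \int[uniform_body K]_v g (v *m M).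
Proof.
move=> mg g0; have mM := measurable_rV_mul M.
have m1 (L : convex_body R d) : measurable_fun [set: 'rV[R]_d] (fun v => (\1_L v)%:E :
    \bar R).
  by apply/measurable_EFinP; apply: measurable_indic; exact: measurable_body.
rewrite !integral_uniform_body//; last exact: (measurableT_comp mg).
rewrite (change_var_unit uM); last 2 first.
- exact: emeasurable_funM.
- by move=> v; rewrite mule_ge0// lee_fin.
have imE v : (linear_image : set _) (v *m M) = (K : set _) v.
  apply/propext; split => [[w Kw] |Kv]; last by exists v.
  by move/(can_inj (mulmxK uM)) => <-.
have -> : lebesgue_rV linear_image = (`|\det M|%R)%:E * lebesgue_rV K.
  rewrite (lebesgue_rV_preimage 0 uM (measurable_body _)); congr (_ * lebesgue_rV _).
  by apply/funext => v; rewrite -[RHS]imE -[v *m M]add0r.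
rewrite muleA fineM//; last first.
  by rewrite ge0_fin_numE ?lebesgue_body_lty// measure_ge0.
rewrite /= -EFinM invfM mulrAC mulVf ?normr_eq0 -?unitfE -?unitmxE// mul1r.
congr (_ * _); apply: eq_integral => v _.
rewrite !indicE (_ : (v *m M \in (linear_image : set _)) = (v \in (K : set _)))//.
by apply/idP/idP => /set_mem h; apply/mem_set; rewrite ?imE// -imE.
Qed.

End linear_image.

End uniform_integral.

Section determinants.
Context {R : realType}.

Lemma measurable_det d (T : measurableType d) n (A : T -> 'M[R]_n) :
  (forall i j, measurable_fun [set: T] (fun t => A t i j)) ->
  measurable_fun [set: T] (fun t => \det (A t)).
Proof.
move=> mA; apply: measurable_sum => s; apply: measurable_funM; first exact: measurable_cst.
by apply: measurable_prod => i _.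
Qed.

Lemma measurable_mulmx d (T : measurableType d) m n p (A : T -> 'M[R]_(m, n)) (B : T ->
    'M[R]_(n, p)) :
  (forall i j, measurable_fun [set: T] (fun t => A t i j)) ->
  (forall i j, measurable_fun [set: T] (fun t => B t i j)) ->
  forall i j, measurable_fun [set: T] (fun t => (A t *m B t) i j).
Proof.
move=> mA mB i j; under eq_fun do rewrite mxE.
by apply: measurable_sum => l; exact: measurable_funM.
Qed.

Lemma cvg_det T (F : set_system T) {FF : Filter F} n (A : T -> 'M[R]_n) (B : 'M[R]_n) :
  (forall i j, A t i j @[t --> F] --> B i j) -> \det (A t) @[t --> F] --> \det B.
Proof.
move=> AB; apply: cvg_sum_R => s; apply: cvgM; first exact: cvg_cst.
by apply: cvg_prod_R => i.
Qed.

Lemma cvg_mulmx_entry T (F : set_system T) {FF : Filter F} m n p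
    (A : T -> 'M[R]_(m, n)) (B : T -> 'M[R]_(n, p)) (A0 : 'M[R]_(m, n)) (B0 : 'M[R]_(n,
        p)) :
  (forall i j, A t i j @[t --> F] --> A0 i j) ->
  (forall i j, B t i j @[t --> F] --> B0 i j) ->
  forall i j, (A t *m B t) i j @[t --> F] --> (A0 *m B0) i j.
Proof.
move=> cA cB i j; rewrite mxE; under eq_fun do rewrite mxE.
by apply: cvg_sum_R => l; exact: cvgM.
Qed.

(** A crude bound by the Leibniz formula, enough for a dominating constant. *)
Lemma det_le n (A : 'M[R]_n) (b : R) : (forall i j, `|A i j| <= b) ->
  `|\det A| <= b ^+ n *+ #|{: {perm 'I_n}}|.
Proof.
move=> Ab; rewrite -sumr_const; apply: (le_trans (ler_norm_sum _ _ _)).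
apply: ler_sum => s _; rewrite normrM normrX normrN1 expr1n mul1r normr_prod.
apply: (@le_trans _ _ (\prod_(i < n) b)); last by rewrite prodr_const card_ord.
by apply: ler_prod => i _; rewrite normr_ge0 Ab.
Qed.

Lemma mulmx_entry_le m n p (A : 'M[R]_(m, n)) (B : 'M[R]_(n, p)) (a b : R) :
  (forall i j, `|A i j| <= a) -> (forall i j, `|B i j| <= b) ->
  forall i j, `|(A *m B) i j| <= (a * b) *+ n.
Proof.
move=> Aa Bb i j; rewrite mxE -[n in leRHS]card_ord -sumr_const.
apply: (le_trans (ler_norm_sum _ _ _)); apply: ler_sum => l _.
by rewrite normrM ler_pM.
Qed.

End determinants.

Section moments.
Local Open Scope ereal_scope.
Context {R : realType}.
Variables (d m k : nat) (md : (m <= d)%N).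

Lemma measurable_edges (i : 'I_m) (j : 'I_d) :
  measurable_fun [set: m.+1.-tuple 'rV[R]_d] (fun x => edges_mx x i j).
Proof.
under eq_fun do rewrite !mxE.
by apply: measurable_funB; exact: (measurableT_comp (measurable_rV_entry j)
    (measurable_tnth _)).
Qed.

Definition gram (W : 'M[R]_d) (x : m.+1.-tuple 'rV[R]_d) : R :=
  \det (edges_mx x *m W *m (edges_mx x)^T).

Lemma measurable_gram (W : 'M[R]_d) : measurable_fun [set: m.+1.-tuple 'rV[R]_d] (gram W).
Proof.
apply: measurable_det; apply: measurable_mulmx.
  by apply: measurable_mulmx => i j; [exact: measurable_edges|exact: measurable_cst].
by move=> i j; under eq_fun do rewrite mxE; exact: measurable_edges.
Qed.

(* For W = M M^T this is the k-th power of the volume of the simplex x M; it also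
   makes sense for the singular limits of such W. *)
Definition gram_moment (W : 'M[R]_d) (x : m.+1.-tuple 'rV[R]_d) : R :=
  (unit_simplex_volume m * Num.sqrt (gram W x)) ^+ k.

Lemma gram_moment_ge0 W x : (0 <= gram_moment W x)%R.
Proof. by rewrite exprn_ge0// mulr_ge0 ?sqrtr_ge0// ltW// unit_simplex_volume_gt0. Qed.

Lemma measurable_gram_moment (W : 'M[R]_d) :
  measurable_fun [set: m.+1.-tuple 'rV[R]_d] (gram_moment W).
Proof.
apply: measurable_funX; apply: measurable_funM; first exact: measurable_cst.
apply: measurableT_comp; last exact: measurable_gram.
apply: continuous_measurable_fun; exact: sqrt_continuous.
Qed.

(** Moves [M] from the probability space to the integrand, where a limit can be taken. *)
Lemma volume_moment_linear_image (K : convex_body R d) (M : 'M[R]_d) (uM : M \in unitmx) :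
  volume_moment (linear_image K uM) m.+1 k =
  \int[power_measure (uniform_body K) m.+1]_x (gram_moment (M *m M^T) x)%:E.
Proof.
rewrite /volume_moment unlock.
transitivity (\int[power_measure (uniform_body (linear_image K uM)) m.+1]_x
    (gram_moment 1%:M x)%:E).
  apply: eq_integral => x _; congr EFin.
  by rewrite /gram_moment /gram mulmx1 simplex_volumeE.
rewrite (@integral_power_map _ _ _ _ _ (uniform_body K) _ _ (fun _ v => v *m M)%R).
- apply: eq_integral => x _; congr (_ ^+ k)%:E; congr (_ * Num.sqrt (\det _))%R.
  have -> : edges_mx [tuple (tnth x i *m M)%R | i < m.+1] = edges_mx x *m M.
    by apply/row_matrixP => i; rewrite row_mul !rowK !tnth_mktuple mulmxBl.
  by rewrite mulmx1 trmx_mul !mulmxA.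
- by move=> _; exact: measurable_rV_mul.
- by move=> _ g mg g0; exact: integral_uniform_linear_image.
- by apply/measurable_EFinP; exact: measurable_gram_moment.
- by move=> x; rewrite lee_fin gram_moment_ge0.
Qed.

Lemma uniform_body_self (K : convex_body R d) : uniform_body K K = 1.
Proof.
rewrite [LHS]uniform_bodyE setIid -{1}[lebesgue_rV K]fineK.
  by rewrite -EFinM divff// gt_eqF// fine_gt0// lebesgue_body_gt0 lebesgue_body_lty.
by rewrite ge0_fin_numE ?lebesgue_body_lty// measure_ge0.
Qed.

Lemma ae_power_uniform_body (K : convex_body R d) n :
  {ae power_measure (uniform_body K) n, forall x, forall i, (K : set _) (tnth x i)}.
Proof.
have mB : measurable [set x : n.-tuple 'rV[R]_d | forall i, (K : set _) (tnth x i)].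
  by apply: (@measurable_tuple_box _ _ _ (fun=> K : set 'rV[R]_d)) => _;
      exact: measurable_body.
exists (~` [set x | forall i, (K : set _) (tnth x i)]); split => //.
  exact: measurableC.
rewrite [LHS]probability_setC//.
have /= -> := @power_measure_box _ _ _ (uniform_body K) n (fun=> K : set 'rV[R]_d).
  by rewrite big1 ?subee// => i _; exact: uniform_body_self.
by move=> _; exact: measurable_body.
Qed.

Lemma gram_moment_bounded (K : convex_body R d) : exists C : R,
  forall (W : 'M[R]_d) (x : m.+1.-tuple 'rV[R]_d), (forall i j, `|W i j| <= 1)%R ->
      (forall i, (K : set _) (tnth x i)) ->
  (gram_moment W x <= C)%R.
Proof.
have [B [_ /(_ (B + 1)%R) KB]] := compact_bounded (@body_compact _ _ K).
have {}KB v i : (K : set _) v -> (`|v ord0 i| <= B + 1)%R.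
  move=> Kv; have /= := KB _ v Kv; rewrite ltrDl ltr01 => /(_ isT).
  apply: le_trans; rewrite [leRHS]/Num.norm/= mx_normrE.
  by apply/bigmax_geP; right => /=; exists (ord0, i).
(* [b] bounds the edge entries, which are differences of two coordinates; [b2] bounds the entries of
   the Gram matrix, formed by two products with inner dimension [d]. *)
pose b := ((B + 1) *+ 2)%R; pose b2 := ((b * 1) *+ d * b *+ d)%R.
exists ((unit_simplex_volume m * Num.sqrt (b2 ^+ m *+ #|{: {perm 'I_m}}|)) ^+ k)%R => W
    x W1 Kx.
have eb i j : (`|edges_mx x i j| <= b)%R.
  by rewrite !mxE (le_trans (ler_normB _ _))// /b mulr2n lerD// KB.
rewrite /gram_moment lerXn2r ?nnegrE ?mulr_ge0 ?sqrtr_ge0 ?(ltW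
    (unit_simplex_volume_gt0 m))//.
rewrite ler_wpM2l ?(ltW (unit_simplex_volume_gt0 m))// ler_wsqrtr//.
apply: (le_trans (ler_norm _)); apply: det_le; apply: mulmx_entry_le.
  exact: mulmx_entry_le.
by move=> i j; rewrite mxE.
Qed.

Lemma cvg_gram_moment (K : convex_body R d) (W_ : nat -> 'M[R]_d) (W : 'M[R]_d) :
  (forall i j, W_ l i j @[l --> \oo] --> W i j) ->
  (forall l i j, `|W_ l i j| <= 1)%R ->
  \int[power_measure (uniform_body K) m.+1]_x (gram_moment (W_ l) x)%:E @[l --> \oo] -->
  \int[power_measure (uniform_body K) m.+1]_x (gram_moment W x)%:E.
Proof.
move=> cW W1; have [C CP] := gram_moment_bounded K.
have [|||||_ _] := @dominated_convergence _ _ _ (power_measure (uniform_body K) m.+1) setT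
  measurableT (fun l x => (gram_moment (W_ l) x)%:E) (fun x => (gram_moment W x)%:E)
  (cst C%:E); last exact.
- by move=> l; apply/measurable_EFinP; exact: measurable_gram_moment.
- by apply/measurable_EFinP; exact: measurable_gram_moment.
- apply/aeW => x _; apply: cvg_EFin; first by apply: nearW.
  have cg : gram (W_ l) x @[l --> \oo] --> gram W x.
    apply: cvg_det; apply: cvg_mulmx_entry; last by move=> i j; exact: cvg_cst.
    by apply: cvg_mulmx_entry => // i j; exact: cvg_cst.
  have cs : Num.sqrt (gram (W_ l) x) @[l --> \oo] --> Num.sqrt (gram W x).
    by apply: continuous_cvg => //; exact: sqrt_continuous.
  have cm := cvgM (cvg_cst (unit_simplex_volume m)) cs.
  have ck : gram_moment (W_ l) x @[l --> \oo] --> gram_moment W x.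
    apply: (@continuous_cvg _ _ _ _ _ _ (fun r : R => (r ^+ k)%R)); [
        exact: exprn_continuous|exact: cm].
  exact: ck.
- exact: finite_measure_integrable_cst.
- apply: filterS (ae_power_uniform_body K m.+1) => x Kx l _.
  by rewrite /= lee_fin ger0_norm ?gram_moment_ge0// CP.
Qed.

End moments.

(** * The two bodies and their coupling *)

Section bodies.
Local Open Scope ereal_scope.
Context {R : realType} (e : nat).
Local Notation leb := (@lebesgue_measure R).
Local Notation lam := (@lebesgue_rV R _).

Definition idx1 : 'I_e.+2 := lift ord0 ord0.

Definition cube : set 'rV[R]_e.+1 := [set z | forall i, (`|z ord0 i| <= 1)%R].

(* Scaling factor of the slice of large_set at height y. The cut y <= 3 / 2 in
   large_set keeps it positive, so that all slices are images of the cube by an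
   invertible matrix. *)
Definition width (y : R) : R := Num.min 1%R (2 - y)%R.

Definition small_set : set 'rV[R]_e.+2 := [set v | (0 <= v ord0 ord0 <= 1)%R /\
  forall j : 'I_e.+1, (`|v ord0 (lift ord0 j)| <= 1)%R].

Definition large_set : set 'rV[R]_e.+2 := [set v | [/\ (0 <= v ord0 ord0 <= 3 / 2)%R,
  forall j : 'I_e.+1, (`|v ord0 (lift ord0 j)| <= 1)%R &
  (`|v ord0 idx1| + v ord0 ord0 <= 2)%R]].

Lemma small_large : small_set `<=` large_set.
Proof.
move=> v [/andP[v0 v1] vj]; split => //; first by rewrite v0/=; lra.
by have := vj ord0; rewrite /idx1; lra.
Qed.

Lemma norm_convex (x y t : R) (c : R) : (0 <= t -> t <= 1 -> `|x| <= c -> `|y| <= c ->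
  `|t * x + (1 - t) * y| <= c)%R.
Proof.
move=> t0 t1 xc yc; rewrite (le_trans (ler_normD _ _))// !normrM (ger0_norm t0).
have t1' : (0 <= 1 - t)%R by rewrite subr_ge0.
rewrite (ger0_norm t1'); have : (t * `|x| <= t * c)%R by rewrite ler_wpM2l.
have : ((1 - t) * `|y| <= (1 - t) * c)%R by rewrite ler_wpM2l.
by nra.
Qed.

Lemma convex_small : convex_set small_set.
Proof.
apply/convex_setP => x y t [/andP[x0 x1] xj] [/andP[y0 y1] yj] t0 t1; split => [|j].
  by rewrite !mxE; apply/andP; split; nra.
by rewrite !mxE norm_convex.
Qed.

Lemma convex_large : convex_set large_set.
Proof.
apply/convex_setP => x y t [/andP[x0 x1] xj x2] [/andP[y0 y1] yj y2] t0 t1; split => [|j|].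
- by rewrite !mxE; apply/andP; split; nra.
- by rewrite !mxE norm_convex.
- rewrite !mxE; rewrite -lerBrDr; apply/ler_normlP; move: x2 y2.
  rewrite -!lerBrDr => /ler_normlP[x3 x4] /ler_normlP[y3 y4].
  by split; nra.
Qed.

Lemma compact_large : compact large_set.
Proof.
apply: bounded_closed_compact.
  exists 2%R; split => // M M2 v [/andP[v0 v1] vj _] /=.
  rewrite [leLHS]/Num.Def.normr/= mx_normrE (bigmax_le _ _)//= => [|[i j] _]; first by lra.
  rewrite (ord1 i)/=; have [l ->|->] := unliftP ord0 j; last by rewrite ger0_norm//; lra.
  by have := vj l; lra.
have cc i : continuous (fun v : 'rV[R]_e.+2 => v ord0 i) by exact: coord_continuous.
have cn i : continuous (fun v : 'rV[R]_e.+2 => `|v ord0 i|%R).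
  by move=> v; apply: continuous_comp; [exact: cc|exact: norm_continuous].
have -> : large_set = ((fun v : 'rV[R]_e.+2 => v ord0 ord0) @^-1` [set r | 0 <= r]%R `&`
    (fun v : 'rV[R]_e.+2 => v ord0 ord0) @^-1` [set r | r <= 3 / 2]%R) `&`
    (\bigcap_(j : 'I_e.+1) (fun v : 'rV[R]_e.+2 => `|v ord0 (lift ord0 j)|%R) @^-1`
        [set r | r <= 1]%R) `&`
    (fun v : 'rV[R]_e.+2 => `|v ord0 idx1| + v ord0 ord0)%R @^-1` [set r | r <= 2]%R.
  apply/seteqP; split => v /=.
    by move=> [/andP[v0 v1] vj v2]; split => //; split => // j _; exact: vj.
  by move=> [[[v0 v1] vj] v2]; split => //; [rewrite v0|move=> j; exact: vj].
apply: closedI; last first.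
  by apply: preimage_closed; [move=> v _; apply: (@continuousD _ _ _
      (fun w : 'rV[R]_e.+2 => `|w ord0 idx1|%R)); [exact: cn|exact: cc]|exact: closed_le].
apply: closedI; last first.
  by apply: closed_bigI => j _; apply: preimage_closed; [move=> v _; exact: cn|
      exact: closed_le].
apply: closedI; apply: preimage_closed; try by move=> v _; exact: cc.
  exact: closed_ge.
exact: closed_le.
Qed.

Lemma compact_small : compact small_set.
Proof.
have -> : small_set = large_set `&` (fun v : 'rV[R]_e.+2 => v ord0 ord0) @^-1` [set r |
    r <= 1]%R.
  apply/seteqP; split => v /=.
    by move=> vs; split; [exact: small_large|case: vs => /andP[]].
  by move=> [[/andP[v0 _] vj _] v1]; split => //; rewrite v0.
apply: compact_closedI; first exact: compact_large.
by apply: preimage_closed; [move=> v _; exact: coord_continuous|exact: closed_le].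
Qed.

Lemma interior_small : small_set° !=set0.
Proof.
exists (const_mx (1 / 2)%R); apply/nbhs_ballP; exists (1 / 2)%R => /=; first by lra.
move=> v [_ cv].
have cvj j : (`|1 / 2 - v ord0 j| < 1 / 2)%R.
  by have := cv ord0 j; rewrite mxE.
split => [|j].
  by have := cvj ord0; rewrite ltr_norml => /andP[h1 h2]; apply/andP; split; lra.
have := cvj (lift ord0 j); rewrite ltr_norml => /andP[h1 h2].
by apply/ler_normlP; split; lra.
Qed.

Lemma interior_large : large_set° !=set0.
Proof.
have [v vs] := interior_small; exists v.
exact: (interiorS small_large).
Qed.

Definition small_body : convex_body R e.+2 :=
  ConvexBody compact_small convex_small interior_small.

Definition large_body : convex_body R e.+2 :=
  ConvexBody compact_large convex_large interior_large.

(** Acts on the coordinates other than the height, so its index [ord0] is [idx1] of the whole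
    space. *)
Definition scale_mx (s : R) : 'M[R]_e.+1 :=
  diag_mx (\row_(i < e.+1) if i == ord0 then s else 1%R).

Lemma mul_scale_mx (z : 'rV[R]_e.+1) s (i : 'I_e.+1) :
  (z *m scale_mx s)%R ord0 i = (z ord0 i * (if i == ord0 then s else 1))%R.
Proof. by rewrite /scale_mx mul_mx_diag !mxE. Qed.

Lemma det_scale_mx s : \det (scale_mx s) = s.
Proof.
rewrite det_diag big_ord_recl mxE eqxx big1 ?mulr1// => i _.
by rewrite mxE.
Qed.

Lemma indic_small y (z : 'rV[R]_e.+1) :
  \1_small_set (rV_cons (y, z)) = (\1_(`[0%R, 1%R]%classic) y * \1_cube z)%R :> R.
Proof.
rewrite !indicE -natrM mulnb; congr ((nat_of_bool _)%:R)%R.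
apply/idP/andP => [/set_mem[+ zj]|[/set_mem y1 /set_mem zj]].
  rewrite rV_cons0 => y1; split; apply/mem_set; first by rewrite /= in_itv.
  by move=> j; have := zj j; rewrite rV_consS.
apply/mem_set; split => [|j]; first by move: y1; rewrite rV_cons0 /= in_itv.
by rewrite rV_consS; exact: zj.
Qed.

(** The two bounds |t| <= 1 and |t| <= 2 - y say together that |t| <= [width y]; dividing t by this
    positive number gives the bound of the cube. *)
Lemma indic_large y (z : 'rV[R]_e.+1) : (y <= 3 / 2)%R ->
  \1_large_set (rV_cons (y, (z *m scale_mx (width y))%R)) =
  (\1_(`[0%R, (3 / 2)%R]%classic) y * \1_cube z)%R :> R.
Proof.
move=> y32.
have w0 : (0 < width y)%R by rewrite /width lt_min ltr01/=; lra.
have wy : (width y <= 1)%R by rewrite /width ge_min lexx.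
have wy2 : (width y <= 2 - y)%R by rewrite /width ge_min lexx orbT.
rewrite !indicE -natrM mulnb; congr ((nat_of_bool _)%:R)%R.
apply/idP/andP => [/set_mem[+ zj]|[/set_mem y1 /set_mem zj]].
  rewrite rV_cons0 => y1 z1; split; apply/mem_set; first by rewrite /= in_itv.
  move=> j; have := zj j; rewrite rV_consS mul_scale_mx; case: eqP => [->|_]; last by
      rewrite mulr1.
  move: z1; rewrite /idx1 rV_consS mul_scale_mx eqxx normrM (gtr0_norm w0) /= => z1 z2.
  rewrite -(@ler_pM2r _ (width y))// mul1r {2}/width le_min z2/=; lra.
apply/mem_set; split => [|j|]; first by move: y1; rewrite rV_cons0 /= in_itv.
  rewrite rV_consS mul_scale_mx; case: eqP => [->|_]; last by rewrite mulr1; exact: zj.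
  rewrite normrM (gtr0_norm w0); have := zj ord0; have := normr_ge0 (z ord0 ord0); nra.
rewrite /idx1 rV_cons0 rV_consS mul_scale_mx eqxx normrM (gtr0_norm w0) /=.
have := zj ord0; have := normr_ge0 (z ord0 ord0); nra.
Qed.

Lemma measurable_cube : measurable cube.
Proof.
rewrite (_ : cube = [set z | forall i, (`[(-1)%R, 1%R]%classic : set (measurableTypeR
    R)) (z ord0 i)]).
  by apply: (measurable_rV_box (A := fun=> `[(-1)%R, 1%R]%classic)) => i;
      exact: measurable_itv.
by apply/seteqP; split => z zc i; have := zc i; rewrite /= in_itv/= ler_norml.
Qed.

End bodies.

Section coupling.
Local Open Scope ereal_scope.
Context {R : realType} (e : nat).
Local Notation leb := (@lebesgue_measure R).
Local Notation lam := (@lebesgue_rV R _).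
Local Notation K := (@small_body R e).
Local Notation L := (@large_body R e).
Local Notation Z := (@cube R e).
Implicit Types g : 'rV[R]_e.+2 -> \bar R.

Let mindic d (T : measurableType d) (A : set T) : measurable A ->
  measurable_fun [set: T] (fun x => (\1_A x)%:E : \bar R).
Proof. by move=> mA; apply/measurable_EFinP; exact: measurable_indic. Qed.

Let mL : measurable_fun [set: 'rV[R]_e.+2] (fun v => (\1_L v)%:E : \bar R).
Proof. by apply: mindic; exact: measurable_body. Qed.

Let mK : measurable_fun [set: 'rV[R]_e.+2] (fun v => (\1_K v)%:E : \bar R).
Proof. by apply: mindic; exact: measurable_body. Qed.

Let mcons y : measurable_fun [set: 'rV[R]_e.+1] (fun z => rV_cons (y : measurableTypeR
    R, z)).
Proof.
exact: (measurableT_comp (@measurable_rV_cons _ _)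
  (pair1_measurable y)).
Qed.

(** Over heights in [0, 3/2] this maps the prism over [cube] onto the large body, slice by slice,
    with Jacobian [width]. *)
Definition width_scale (p : measurableTypeR R * 'rV[R]_e.+1) : 'rV[R]_e.+2 :=
  rV_cons (p.1, p.2 *m scale_mx e (width p.1))%R.

Lemma measurable_width : measurable_fun [set: measurableTypeR R] (@width R : _ ->
    measurableTypeR R).
Proof.
apply: measurable_minr; first exact: measurable_cst.
by apply: measurable_funB.
Qed.

Lemma measurable_width_scale : measurable_fun [set: _] width_scale.
Proof.
apply: measurable_fun_rV => i; have [j ->|->] := unliftP ord0 i; rewrite /width_scale.
  under eq_fun do rewrite rV_consS mul_scale_mx.
  apply: measurable_funM; first exact: (measurableT_comp (measurable_rV_entry j)
      measurable_snd).
  case: eqP => _; last exact: measurable_cst.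
  exact: (measurableT_comp measurable_width measurable_fst).
under eq_fun do rewrite rV_cons0.
exact: measurable_fst.
Qed.

Lemma integral_small g : measurable_fun [set: _] g -> (forall v, 0 <= g v) ->
  \int[lam]_v (g v * (\1_K v)%:E) =
  \int[leb]_y ((\1_(`[0%R, 1%R]%classic) y)%:E *
    \int[lam]_z (g (rV_cons (y, z)) * (\1_Z z)%:E)).
Proof.
move=> mg g0; rewrite integral_rV_cons//; last 2 first.
- exact: emeasurable_funM.
- by move=> v; rewrite mule_ge0// lee_fin.
apply: eq_integral => y _.
rewrite -ge0_integralZl//; last 2 first.
- apply: emeasurable_funM; first exact: (measurableT_comp mg (mcons y)).
  by apply: mindic; exact: measurable_cube.
- by move=> z _; rewrite mule_ge0// lee_fin.
by apply: eq_integral => z _; rewrite [X in X%:E](indic_small y z) EFinM muleCA.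
Qed.

(** The integral of [g] over the slice of the large body at height [y], without its Jacobian factor
    [width y]. *)
Definition slab_integral g y : \bar R :=
  \int[lam]_z (g (width_scale (y, z)) * (\1_Z z)%:E).

Lemma integral_large g : measurable_fun [set: _] g -> (forall v, 0 <= g v) ->
  \int[lam]_v (g v * (\1_L v)%:E) =
  \int[leb]_y ((\1_(`[0%R, (3 / 2)%R]%classic) y)%:E * (width y)%:E * slab_integral g y).
Proof.
move=> mg g0; rewrite integral_rV_cons//; last 2 first.
- exact: emeasurable_funM.
- by move=> v; rewrite mule_ge0// lee_fin.
apply: eq_integral => y _.
(* Above 3/2 both sides vanish, and there [scale_mx] need not be invertible. *)
have [y32|y32] := leP y (3 / 2)%R; last first.
  rewrite indicE memNset; last by rewrite /= in_itv/= => /andP[_]; rewrite leNgt y32.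
  rewrite !mul0e; apply: integral0_eq => z _.
  rewrite indicE memNset ?mule0// => -[]; rewrite rV_cons0/= => /andP[_].
  by rewrite leNgt y32.
have w0 : (0 < width y)%R by rewrite /width lt_min ltr01/=; lra.
have uS : scale_mx e (width y) \in unitmx.
  by rewrite unitmxE unitfE det_scale_mx gt_eqF.
rewrite (change_var_unit uS); last 2 first.
- apply: emeasurable_funM; first exact: (measurableT_comp mg (mcons y)).
  exact: (measurableT_comp mL (mcons y)).
- by move=> z; rewrite mule_ge0// lee_fin.
rewrite det_scale_mx gtr0_norm// -muleA muleCA; congr (_ * _).
rewrite -ge0_integralZl//; last 2 first.
- apply: emeasurable_funM.
    apply: (measurableT_comp mg).
    exact: (measurableT_comp measurable_width_scale
      (pair1_measurable y)).
  by apply: mindic; exact: measurable_cube.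
- by move=> z _; rewrite mule_ge0// lee_fin.
by apply: eq_integral => z _; rewrite [X in X%:E](indic_large z y32) EFinM muleCA.
Qed.

Lemma measurable_slab_integral g : measurable_fun [set: _] g -> (forall v, 0 <= g v) ->
  measurable_fun [set: measurableTypeR R] (slab_integral g).
Proof.
move=> mg g0.
apply: (measurable_integral_rV_cons (h := fun p => g (width_scale p) * (\1_Z p.2)%:E))
    => [|p].
  apply: emeasurable_funM; first exact: (measurableT_comp mg measurable_width_scale).
  exact: (measurableT_comp (mindic (@measurable_cube R e)) measurable_snd).
by rewrite mule_ge0// lee_fin.
Qed.

Lemma slab_integral_ge0 g y : (forall v, 0 <= g v) -> 0 <= slab_integral g y.
Proof. by move=> g0; apply: integral_ge0 => z _; rewrite mule_ge0// lee_fin. Qed.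

Lemma integral_indic01 (c : \bar R) : 0 <= c ->
  \int[leb]_y ((\1_(`[0%R, 1%R]%classic) y)%:E * c) = c.
Proof.
move=> c0; rewrite ge0_integralZr//; last exact: mindic.
by rewrite integral_indic// setIT/= lebesgue_measure_itv/= lte_fin ltr01 sube0 mul1e.
Qed.

(** The height of the small body fills an interval of length one. *)
Lemma lebesgue_small : lam K = \int[lam]_z (\1_Z z)%:E.
Proof.
transitivity (lam ((K : set _) `&` setT)); first by rewrite setIT.
rewrite -integral_indic//; last exact: measurable_body.
transitivity (\int[lam]_v (cst 1 v * (\1_K v)%:E)).
  by apply: eq_integral => v _; rewrite mul1e.
rewrite integral_small// -[RHS]integral_indic01; last first.
  by apply: integral_ge0 => z _; rewrite lee_fin.
apply: eq_integral => y _; congr (_ * _).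
by apply: eq_integral => z _; rewrite mul1e.
Qed.

Definition resample (p : 'rV[R]_e.+2 * 'rV[R]_e.+2) : 'rV[R]_e.+2 :=
  width_scale (p.1 ord0 ord0, \row_j p.2 ord0 (lift ord0 j))%R.

Lemma measurable_resample : measurable_fun [set: _] resample.
Proof.
apply: (measurableT_comp measurable_width_scale); apply: measurable_fun_pair.
  exact: (measurableT_comp (measurable_rV_entry ord0) measurable_fst).
apply: measurable_fun_rV => j; under eq_fun do rewrite mxE.
exact: (measurableT_comp (measurable_rV_entry (lift ord0 j)) measurable_snd).
Qed.

(** Under the uniform law of the large body the height has density proportional to [width], and
    given the height the rest is a scaled uniform point of the cube. The point [u] supplies only the
    height and [v] only the rest, so the pair has the same law. *)
Lemma uniform_large_resample g : measurable_fun [set: _] g -> (forall v, 0 <= g v) ->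
  \int[uniform_body L]_v g v =
  \int[uniform_body L]_u \int[uniform_body K]_v g (resample (u, v)).
Proof.
move=> mg g0; set zeta := fine (lam K).
have z0 : (0 < zeta)%R by rewrite fine_gt0// lebesgue_body_gt0 lebesgue_body_lty.
have zE : lam K = zeta%:E.
  by rewrite /zeta fineK// ge0_fin_numE ?lebesgue_body_lty// measure_ge0.
have mslab := measurable_slab_integral mg g0.
have slab0 y := slab_integral_ge0 y g0.
have inner u : \int[uniform_body K]_v g (resample (u, v)) =
    (zeta^-1)%:E * slab_integral g (u ord0 ord0).
  rewrite integral_uniform_body//; last first.
    exact: (measurableT_comp mg (measurableT_comp measurable_resample
      (pair1_measurable u))).
  congr (_ * _); rewrite (integral_small (g := fun v => g (resample (u, v))))//; last first.
    exact: (measurableT_comp mg (measurableT_comp measurable_resample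
      (pair1_measurable u))).
  rewrite -[RHS](integral_indic01 (slab0 _)).
  apply: eq_integral => y _.
  congr (_ * _).
  apply: eq_integral => z _.
  congr (g _ * _).
  by congr (width_scale (_, _)); apply/rowP => j; rewrite mxE rV_consS.
under [RHS]eq_integral do rewrite inner.
have mslab0 : measurable_fun [set: 'rV[R]_e.+2] (fun u => slab_integral g (u ord0 ord0)).
  exact: (measurableT_comp mslab (measurable_rV_entry ord0)).
have zi0 : (0 <= zeta^-1)%R by rewrite invr_ge0 ltW.
rewrite ge0_integralZl; [|exact: measurableT|exact: mslab0|by move=> u _;
    exact: slab0|by rewrite lee_fin].
rewrite !integral_uniform_body; [|exact: mslab0|by move=> u; exact: slab0|
    exact: mg|exact: g0].
rewrite [RHS]muleCA.
apply: (congr1 (fun x => (fine (lam L))^-1%:E * x)).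
rewrite !integral_large; [|exact: mslab0|by move=> u; exact: slab0|exact: mg|exact: g0].
rewrite -ge0_integralZl; last 4 first.
- exact: measurableT.
- apply: emeasurable_funM; last exact: measurable_slab_integral.
  apply: emeasurable_funM; first by apply: mindic; exact: measurable_itv.
  by apply/measurable_EFinP; exact: measurable_width.
- move=> y _; have [y32|y32] := leP y (3 / 2)%R; last first.
    rewrite indicE memNset; last by rewrite /= in_itv/= => /andP[_]; rewrite leNgt y32.
    by rewrite !mul0e.
  rewrite !mule_ge0 ?lee_fin ?slab_integral_ge0//.
  by rewrite /width le_min ler01/=; lra.
- by rewrite lee_fin.
apply: eq_integral => y _.
rewrite muleCA; congr (_ * _).
rewrite {2}/slab_integral.
(* The function integrated over the slab depends on the height alone: it comes out of the integral,
   and the volume of the cube left behind cancels [zeta]. *)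
rewrite (eq_integral (fun z => slab_integral g y * (\1_Z z)%:E)); last first.
  by move=> z _; rewrite rV_cons0.
rewrite ge0_integralZl; last 4 first.
- exact: measurableT.
- by apply: mindic; exact: measurable_cube.
- by move=> z _; rewrite lee_fin.
- exact: slab0.
by rewrite -lebesgue_small zE muleCA -EFinM mulVf ?gt_eqF// mule1.
Qed.

End coupling.

(** * Contraction of random signs *)

Section sign_sums.
Context {R : realType}.

(** Multiplying the induction hypothesis by ta + (1-t)b leaves the defect t(1-t)(a-b)(a^k-b^k),
    nonnegative because powers are monotone. *)
Lemma convex_exprn (k : nat) (t a b : R) : 0 <= t -> t <= 1 -> 0 <= a -> 0 <= b ->
  (t * a + (1 - t) * b) ^+ k <= t * a ^+ k + (1 - t) * b ^+ k.
Proof.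
move=> t0 t1 a0 b0; have s0 : 0 <= 1 - t by rewrite subr_ge0.
elim: k => [|k IHk]; first by rewrite !expr0 !mulr1 addrC subrK.
have mono : 0 <= (a - b) * (a ^+ k - b ^+ k).
  have [ab|ba] := leP a b.
    by rewrite mulr_le0// subr_le0// lerXn2r.
  by rewrite mulr_ge0// subr_ge0 ?lerXn2r ?nnegrE// ltW.
have := ler_wpM2l (addr_ge0 (mulr_ge0 t0 a0) (mulr_ge0 s0 b0)) IHk.
have := mulr_ge0 (mulr_ge0 t0 s0) mono.
rewrite !exprS; move: (a ^+ k) (b ^+ k) (_ ^+ k) => x y z; lra.
Qed.

(** Both b + u and b - u are convex combinations of b + v and b - v, with the weights [t] and
    [1 - t] exchanged; adding the two convexity inequalities removes [t]. *)
Lemma ler_normXD (k : nat) (b u v : R) : `|u| <= `|v| ->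
  `|b + u| ^+ k + `|b - u| ^+ k <= `|b + v| ^+ k + `|b - v| ^+ k.
Proof.
have [->|v0] := eqVneq v 0; first by rewrite normr0 normr_le0 => /eqP ->.
move=> uv; pose t := (1 + u / v) / 2.
have /ler_normlP[uv1 uv2] : `|u / v| <= 1.
  by rewrite normrM normfV ler_pdivrMr ?mul1r// normr_gt0.
have t0 : 0 <= t by rewrite /t; lra.
have t1 : t <= 1 by rewrite /t; lra.
have conv (x y s : R) : 0 <= s -> s <= 1 ->
    `|s * x + (1 - s) * y| ^+ k <= s * `|x| ^+ k + (1 - s) * `|y| ^+ k.
  move=> s0 s1; have H := convex_exprn k s0 s1 (normr_ge0 x) (normr_ge0 y).
  apply: (le_trans _ H).
  have s0' : 0 <= 1 - s by rewrite subr_ge0.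
  rewrite lerXn2r ?nnegrE ?addr_ge0 ?mulr_ge0//.
  by rewrite (le_trans (ler_normD _ _))// !normrM (ger0_norm s0) (ger0_norm s0').
have -> : b + u = t * (b + v) + (1 - t) * (b - v) by rewrite /t; field.
have -> : b - u = (1 - t) * (b + v) + (1 - (1 - t)) * (b - v) by rewrite /t; field.
have c1 := conv (b + v) (b - v) t t0 t1.
have c2 := conv (b + v) (b - v) (1 - t) _ _.
have := c2; rewrite !subr_ge0 gerBl => /(_ t1 t0) {}c2; lra.
Qed.

(** 2^n times the k-th absolute moment of the Rademacher sum with coefficients [w]. *)
Definition sign_sum n k (w : 'I_n -> R) : R :=
  \sum_(s : {ffun 'I_n -> bool}) `|\sum_i (-1) ^+ (s i) * w i| ^+ k.

(** Pairing each sign pattern with the one that differs at [j] reduces the claim to [ler_normXD].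
    Doubling the sum avoids choosing one pattern from each pair. *)
Lemma sign_sum_le1 n k (j : 'I_n) (w w' : 'I_n -> R) :
  (forall i, i != j -> w i = w' i) -> `|w j| <= `|w' j| -> sign_sum k w <= sign_sum k w'.
Proof.
move=> ww' wj.
pose phi (s : {ffun 'I_n -> bool}) := [ffun i => s i (+) (i == j)].
have phiK : involutive phi.
  by move=> s; apply/ffunP => i; rewrite !ffunE addbK.
have E (z : 'I_n -> R) : sign_sum k z + sign_sum k z =
    \sum_(s : {ffun 'I_n -> bool})
      (`|\sum_(i | i != j) (-1) ^+ (s i) * z i + (-1) ^+ (s j) * z j| ^+ k +
       `|\sum_(i | i != j) (-1) ^+ (s i) * z i - (-1) ^+ (s j) * z j| ^+ k).
  rewrite big_split/=; congr (_ + _).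
    by apply: eq_bigr => s _; rewrite (bigD1 j)//= addrC.
  rewrite /sign_sum (reindex_inj (inv_inj phiK))/=; apply: eq_bigr => s _.
  rewrite (bigD1 j)//= addrC ffunE eqxx addbT; congr (`|_ + _| ^+ k).
    by apply: eq_bigr => i ij; rewrite ffunE (negbTE ij) addbF.
  by case: (s j); rewrite /= ?expr0 ?expr1 !(mulN1r, mul1r) ?opprK.
suff : sign_sum k w + sign_sum k w <= sign_sum k w' + sign_sum k w' by lra.
rewrite !E; apply: ler_sum => s _.
rewrite (eq_bigr (fun i => (-1) ^+ (s i) * w' i)) => [|i ij]; last by rewrite ww'.
by apply: ler_normXD; rewrite !normrM !normrX !normrN1 !expr1n !mul1r.
Qed.

(** The contraction principle: the coefficients are replaced one at a time, [z l] having the first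
    [l] already replaced. *)
Lemma sign_sum_le n k (w w' : 'I_n -> R) :
  (forall i, `|w i| <= `|w' i|) -> sign_sum k w <= sign_sum k w'.
Proof.
move=> ww'; pose z (l : nat) (i : 'I_n) := if (i < l)%N then w' i else w i.
have H l : (l <= n)%N -> sign_sum k w <= sign_sum k (z l).
  elim: l => [_|l IHl ln]; first exact: lexx.
  apply: (le_trans (IHl (ltnW ln))); apply: (@sign_sum_le1 _ _ (Ordinal ln)).
    by move=> i il; rewrite /z ltnS (leq_eqVlt i) -[_ == l]/(i == Ordinal ln) (negbTE il).
  by rewrite /z/= ltnn ltnSn.
apply: le_trans (H n (leqnn n)) _.
by rewrite le_eqVlt; apply/orP; left; apply/eqP; congr sign_sum; apply/funext => i;
    rewrite /z ltn_ord.
Qed.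

Lemma sign_sumZ n k (w : 'I_n -> R) (c : R) : 0 <= c ->
  sign_sum k (fun i => c * w i) = c ^+ k * sign_sum k w.
Proof.
move=> c0; rewrite /sign_sum mulr_sumr; apply: eq_bigr => s _.
rewrite -(ger0_norm c0) -normrX -!normrX -normrM -exprMn; congr (`|_ ^+ k|).
by rewrite (ger0_norm c0) mulr_sumr; apply: eq_bigr => i _; rewrite mulrCA.
Qed.

End sign_sums.

(** * The limit determinant as a linear form in the scaled coordinate *)

Section main_det.
Context {R : realType} (e m : nat) (hm : (m < e.+1)%N).

(* Projection onto the main coordinates 1, ..., m.+1; the coordinate 0 is the
   height in the two bodies, and idx1 = 1 is the scaled coordinate. *)
Definition main_mx : 'M[R]_(e.+2, m.+1) :=
  \matrix_(i, j) (i == j.+1 :> nat)%:R.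

Definition main_edges (x : m.+2.-tuple 'rV[R]_e.+2) : 'M[R]_m.+1 :=
  edges_mx x *m main_mx.

Definition main_det (x : m.+2.-tuple 'rV[R]_e.+2) : R := \det (main_edges x).

Definition main_idx (j : 'I_m.+1) : 'I_e.+2 := lift ord0 (widen_ord hm j).

Lemma main_edgesE x i j : main_edges x i j =
  tnth x (lift ord0 i) ord0 (main_idx j) - tnth x ord0 ord0 (main_idx j).
Proof.
rewrite mxE (bigD1 (main_idx j))//= big1 ?addr0 => [|l lj].
  by rewrite !mxE eqxx mulr1.
rewrite [main_mx _ _]mxE; case: eqP => [lE|_]; last by rewrite mulr0.
by move: lj; rewrite -(inj_eq val_inj)/= lE eqxx.
Qed.

(** Vertex 0 is subtracted in every edge, so its coefficient is minus the sum of all the others. *)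
Definition main_coef x (i : 'I_m.+2) : R :=
  if unlift ord0 i is Some j then cofactor (main_edges x) j ord0
  else - \sum_j cofactor (main_edges x) j ord0.

Lemma main_detE x : main_det x = \sum_i main_coef x i * tnth x i ord0 (idx1 e).
Proof.
rewrite /main_det (expand_det_col _ ord0) [RHS]big_ord_recl /main_coef unlift_none.
rewrite mulNr mulr_suml addrC -sumrB; apply: eq_bigr => i _.
rewrite liftK main_edgesE (_ : main_idx ord0 = idx1 e); last exact: val_inj.
by ring.
Qed.

(* The coefficients of the expansion along the first column do not involve the
   coordinates 0 and 1. *)
Lemma main_coef_eq (x y : m.+2.-tuple 'rV[R]_e.+2) :
  (forall i (j : 'I_e.+1), j != ord0 ->
    tnth x i ord0 (lift ord0 j) = tnth y i ord0 (lift ord0 j)) ->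
  main_coef x =1 main_coef y.
Proof.
move=> xy; have cE j : cofactor (main_edges x) j ord0 = cofactor (main_edges y) j ord0.
  rewrite /cofactor; congr (_ * \det _); apply/matrixP => a b.
  by rewrite [LHS]mxE [LHS]mxE [RHS]mxE [RHS]mxE !main_edgesE !xy.
move=> i; rewrite /main_coef; case: unliftP => [j _|_]; first exact: cE.
by congr (- _); apply: eq_bigr => j _; exact: cE.
Qed.

End main_det.

Section flip.
Local Open Scope ereal_scope.
Context {R : realType} (e : nat).
Local Notation K := (@small_body R e).

Definition flip_mx (b : bool) : 'M[R]_e.+2 :=
  diag_mx (\row_(i < e.+2) if i == idx1 e then (-1) ^+ b else 1)%R.

Lemma mul_flip_mx (v : 'rV[R]_e.+2) b i :
  (v *m flip_mx b)%R ord0 i = (v ord0 i * (if i == idx1 e then (-1) ^+ b else 1))%R.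
Proof. by rewrite /flip_mx mul_mx_diag !mxE. Qed.

Lemma norm_flip_mx (v : 'rV[R]_e.+2) b i : (`|(v *m flip_mx b)%R ord0 i| = `|v ord0 i|)%R.
Proof.
by rewrite mul_flip_mx; case: eqP => _; rewrite ?mulr1// normrM normrX normrN1 expr1n mulr1.
Qed.

Lemma norm_det_flip_mx b : (`|\det (flip_mx b)| = 1)%R.
Proof.
rewrite det_diag normr_prod big1// => i _; rewrite mxE.
by case: eqP => _; rewrite ?normr1// normrX normrN1 expr1n.
Qed.

Lemma integral_uniform_flip b g : measurable_fun [set: 'rV[R]_e.+2] g -> (forall v, 0
    <= g v) ->
  \int[uniform_body K]_v g v = \int[uniform_body K]_v g (v *m flip_mx b)%R.
Proof.
move=> mg g0; have mgf := measurableT_comp mg (measurable_rV_mul (flip_mx b)).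
rewrite !integral_uniform_body//; apply: (congr1 (fun x => _ * x)).
have uf : flip_mx b \in unitmx.
  by rewrite unitmxE unitfE -normr_eq0 norm_det_flip_mx oner_eq0.
rewrite (change_var_unit uf); last 2 first.
- apply: emeasurable_funM => //; apply/measurable_EFinP; apply: measurable_indic.
  exact: measurable_body.
- by move=> v; rewrite mule_ge0// lee_fin.
rewrite norm_det_flip_mx mul1e; apply: eq_integral => v _; congr (_ * _%:E).
rewrite !indicE; congr (((nat_of_bool _)%:R)%R).
have f0 : (v *m flip_mx b)%R ord0 ord0 = v ord0 ord0 by rewrite mul_flip_mx mulr1.
apply/idP/idP => /set_mem[v0 vj]; apply/mem_set; split.
- by rewrite -f0.
- by move=> j; rewrite -(norm_flip_mx v b).
- by rewrite f0.
- by move=> j; rewrite norm_flip_mx.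
Qed.

End flip.

(** * Comparison of the limit moments *)

Section positivity.
Local Open Scope ereal_scope.
Context {R : realType} (d : nat) (K : convex_body R d).

Definition open_box (v : 'rV[R]_d) (r : R) : set 'rV[R]_d :=
  [set w | forall i, (`|w ord0 i - v ord0 i| < r)%R].

Lemma open_boxE v r : open_box v r =
  [set w | forall i, (`](v ord0 i - r)%R, (v ord0 i + r)%R[%classic : set
      (measurableTypeR R)) (w ord0 i)].
Proof.
by apply/seteqP; split => w wv i; have := wv i; rewrite /= in_itv/= ltr_distl.
Qed.

Lemma measurable_open_box v r : measurable (open_box v r).
Proof.
rewrite open_boxE; apply: (measurable_rV_box
  (A := fun i => `](v ord0 i - r)%R, (v ord0 i + r)%R[%classic)) => i.
exact: measurable_itv.
Qed.

Lemma uniform_open_box_gt0 v r : (0 < r)%R -> open_box v r `<=` K ->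
  0 < uniform_body K (open_box v r).
Proof.
move=> r0 vK; rewrite [X in _ < X]uniform_bodyE setIidl//; apply: mule_gt0; last first.
  by rewrite lte_fin invr_gt0 fine_gt0// lebesgue_body_gt0 lebesgue_body_lty.
rewrite open_boxE (@lebesgue_rV_box R d
  (fun i => `](v ord0 i - r)%R, (v ord0 i + r)%R[%classic)) => [|i]; last
      exact: measurable_itv.
elim/big_ind : _ => // [x y|i _]; first exact: mule_gt0.
rewrite lebesgue_measure_itv/= lte_fin ifT ?lte_fin; lra.
Qed.

End positivity.

Section sign_average.
Local Open Scope ereal_scope.
Context {R : realType} (e m k : nat) (hm : (m < e.+1)%N).
Local Notation K := (@small_body R e).
Local Notation L := (@large_body R e).
Local Notation T := (m.+2.-tuple 'rV[R]_e.+2).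

Definition main_pow (x : T) : \bar R := ((`|main_det x| ^+ k)%R)%:E.

Lemma main_pow_ge0 x : 0 <= main_pow x.
Proof. by rewrite lee_fin exprn_ge0. Qed.

Lemma measurable_main_det : measurable_fun [set: T] (@main_det R e m).
Proof.
apply: measurable_det => i j; under eq_fun do rewrite (main_edgesE hm).
by apply: measurable_funB; exact: (measurableT_comp (measurable_rV_entry _)
    (measurable_tnth _)).
Qed.

Lemma measurable_main_pow : measurable_fun [set: T] main_pow.
Proof.
apply/measurable_EFinP; apply: measurable_funX.
by apply: measurableT_comp => //; exact: measurable_main_det.
Qed.

Definition resample_tuple (p : T * T) : T := [tuple resample (tnth p.1 i, tnth p.2 i) |
    i < m.+2].

Definition flip_tuple (s : {ffun 'I_m.+2 -> bool}) (v : T) : T :=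
  [tuple (tnth v i *m flip_mx e (s i))%R | i < m.+2].

Lemma measurable_resample_tuple : measurable_fun [set: T * T] resample_tuple.
Proof.
apply: (@measurable_tuple_of _ _ _ _ _ (fun i (p : T * T) => resample (tnth p.1 i, tnth
    p.2 i))) => i.
apply: (measurableT_comp (@measurable_resample R e)); apply: measurable_fun_pair.
  exact: (measurableT_comp (measurable_tnth i) measurable_fst).
exact: (measurableT_comp (measurable_tnth i) measurable_snd).
Qed.

Lemma measurable_flip_tuple s : measurable_fun [set: T] (flip_tuple s).
Proof.
apply: (@measurable_tuple_of _ _ _ _ _ (fun i (v : T) => tnth v i *m flip_mx e (s
    i))%R) => i.
exact: (measurableT_comp (measurable_rV_mul _) (measurable_tnth i)).
Qed.

Lemma main_det_flip (s : {ffun 'I_m.+2 -> bool}) (v : T) :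
  main_det (flip_tuple s v) =
  (\sum_i (-1) ^+ (s i) * (main_coef v i * tnth v i ord0 (idx1 e)))%R.
Proof.
rewrite (main_detE hm); apply: eq_bigr => i _.
rewrite tnth_mktuple mul_flip_mx eqxx mulrC -mulrA mulrCA.
rewrite (mulrC (tnth v i _ _)); congr (_ * (_ * _))%R; apply: (main_coef_eq hm) => l j j0.
rewrite tnth_mktuple mul_flip_mx ifF ?mulr1//.
by apply/negbTE; rewrite /idx1 (inj_eq lift_inj).
Qed.

(** Resampling and flipping alter only the height and t, which the cofactors do not see. Compared
    with [main_det_flip], each term merely gains the factor [width] at the height of [u]. *)
Lemma main_det_resample_flip (s : {ffun 'I_m.+2 -> bool}) (u v : T) :
  main_det (resample_tuple (u, flip_tuple s v)) =
  (\sum_i (-1) ^+ (s i) * (width (tnth u i ord0 ord0) * (main_coef v i * tnth v i ord0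
      (idx1 e))))%R.
Proof.
rewrite (main_detE hm); apply: eq_bigr => i _.
have resE j l : tnth (resample_tuple (u, flip_tuple s v)) l ord0 (lift ord0 j) =
    (tnth v l ord0 (lift ord0 j) *
     (if j == ord0 then (-1) ^+ (s l) * width (tnth u l ord0 ord0) else 1))%R.
  rewrite tnth_mktuple /resample /width_scale rV_consS mul_scale_mx/= mxE tnth_mktuple
      mul_flip_mx.
  by rewrite (inj_eq lift_inj); case: eqP => [->|_]; rewrite ?mulr1// mulrA.
rewrite /idx1 resE eqxx.
have -> : main_coef (resample_tuple (u, flip_tuple s v)) i = main_coef v i.
  by apply: (main_coef_eq hm) => l j j0; rewrite resE (negbTE j0) mulr1.
by ring.
Qed.

Lemma integral_flip_tuple (s : {ffun 'I_m.+2 -> bool}) (F : T -> \bar R) :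
  measurable_fun [set: T] F -> (forall v, 0 <= F v) ->
  \int[power_measure (uniform_body K) m.+2]_v F v =
  \int[power_measure (uniform_body K) m.+2]_v F (flip_tuple s v).
Proof.
move=> mF F0; apply: (@integral_power_map _ _ _ _ _ (uniform_body K) (uniform_body K) _
  (fun i v => v *m flip_mx e (s i))%R) => //.
- by move=> i; exact: measurable_rV_mul.
- by move=> i g mg g0; exact: integral_uniform_flip.
Qed.

(** Each sign pattern preserves the law of the sample. With the sum under the integral, two
    integrands can be compared pointwise, which is false for single patterns. *)
Lemma integral_sign_average (F : T -> \bar R) :
  measurable_fun [set: T] F -> (forall v, 0 <= F v) ->
  (#|{: {ffun 'I_m.+2 -> bool}}|%:R)%:E * \int[power_measure (uniform_body K) m.+2]_v F v =
  \int[power_measure (uniform_body K) m.+2]_v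
    \sum_(s : {ffun 'I_m.+2 -> bool}) F (flip_tuple s v).
Proof.
move=> mF F0; rewrite ge0_integral_sum//; last first.
  by move=> s; apply: (measurableT_comp mF); exact: measurable_flip_tuple.
under eq_bigr do rewrite -integral_flip_tuple//.
by rewrite sumr_const mule_natl.
Qed.

End sign_average.

Section small_large_comparison.
Local Open Scope ereal_scope.
Context {R : realType} (e m k : nat) (hm : (m < e.+1)%N).
Local Notation K := (@small_body R e).
Local Notation L := (@large_body R e).
Local Notation T := (m.+2.-tuple 'rV[R]_e.+2).
Local Notation PK := (power_measure (uniform_body K) m.+2).
Local Notation PL := (power_measure (uniform_body L) m.+2).
Local Notation main_pow := (@main_pow R e m k).

Let mmp := @measurable_main_pow R e m k hm.
Let mp0 := @main_pow_ge0 R e m k.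

Let mres u : measurable_fun [set: T] (fun v => main_pow (resample_tuple (u, v))).
Proof.
exact: (measurableT_comp mmp (measurableT_comp (@measurable_resample_tuple R e m)
  (pair1_measurable u))).
Qed.

(** Contraction with the heights held fixed: after averaging over signs, the integrands are sign
    sums with coefficients w_i a_i and a_i, where |w_i| <= c. *)
Lemma integral_resample_le (u : T) (c : R) :
  (forall i, `|width (tnth u i ord0 ord0)| <= c)%R ->
  \int[PK]_v main_pow (resample_tuple (u, v)) <= ((c ^+ k)%R)%:E * \int[PK]_v main_pow v.
Proof.
move=> uc; have c0 : (0 <= c)%R by apply: le_trans (uc ord0).
have N0 : (0 < #|{: {ffun 'I_m.+2 -> bool}}|%:R :> R)%R.
  by rewrite ltr0n; apply/card_gt0P; exists [ffun=> true].
rewrite -(@lee_pmul2l _ (#|{: {ffun 'I_m.+2 -> bool}}|%:R)%:E)//.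
rewrite integral_sign_average// muleCA integral_sign_average//.
have mS (F : T -> \bar R) : measurable_fun [set: T] F ->
    measurable_fun [set: T] (fun v => \sum_(s : {ffun 'I_m.+2 -> bool}) F (flip_tuple s v)).
  move=> mF; apply: emeasurable_sum => s.
  by apply: (measurableT_comp mF); exact: measurable_flip_tuple.
have S0 (F : T -> \bar R) v : (forall v, 0 <= F v) ->
    0 <= \sum_(s : {ffun 'I_m.+2 -> bool}) F (flip_tuple s v).
  by move=> F0; apply: sume_ge0.
rewrite -ge0_integralZl//; last 3 first.
- exact: mS.
- by move=> v _; exact: S0.
- by rewrite lee_fin exprn_ge0.
apply: ge0_le_integral => //.
- by move=> v _; exact: (S0 (fun v => main_pow (resample_tuple (u, v)))).
- exact: (mS (fun v => main_pow (resample_tuple (u, v)))).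
- by apply: emeasurable_funM => //; exact: mS.
move=> v _; rewrite /main_pow !sumEFin -EFinM lee_fin.
under eq_bigr do rewrite main_det_resample_flip//.
under [in leRHS]eq_bigr do rewrite main_det_flip//.
rewrite -/(sign_sum k (fun i => width (tnth u i ord0 ord0) * (main_coef v i * tnth v i
    ord0 (idx1 e))))%R.
rewrite -/(sign_sum k (fun i => main_coef v i * tnth v i ord0 (idx1 e)))%R.
rewrite -sign_sumZ//; apply: sign_sum_le => i.
by rewrite !normrM ler_wpM2r ?mulr_ge0// (ger0_norm c0).
Qed.

Lemma integral_large_resample :
  \int[PL]_x main_pow x = \int[PL]_u \int[PK]_v main_pow (resample_tuple (u, v)).
Proof.
apply: (integral_power_couple (psi := @resample R e) (P1 := uniform_body L)
  (P2 := uniform_body K) (P3 := uniform_body L)) => //.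
- exact: measurable_resample.
- by move=> g mg g0; exact: uniform_large_resample.
Qed.

(** All heights lie in ]5/4, 3/2[, where [width] is 2 - y < 3/4; the other coordinates stay below
    1/8 in absolute value, so each box is inside the large body. *)
Let G : set T := [set u | forall i,
  open_box (\row_j (if j == ord0 then 11 / 8 else 0))%R (1 / 8)%R (tnth u i)].

Let mG : measurable G.
Proof.
by apply: (@measurable_tuple_box _ _ _ (fun=> open_box (\row_j (if j == ord0 then 11 /
    8 else 0))%R (1 / 8)%R)) => _; exact: measurable_open_box.
Qed.

Let PG : 0 < PL G.
Proof.
have /= := @power_measure_box _ _ _ (uniform_body L) m.+2
  (fun=> open_box (\row_j (if j == ord0 then 11 / 8 else 0))%R (1 / 8)%R).
rewrite /G => -> => [|_]; last exact: measurable_open_box.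
elim/big_ind : _ => // [x y|i _]; first exact: mule_gt0.
apply: uniform_open_box_gt0; first by lra.
move=> v vb; have v0 := vb ord0; have vj j := vb (lift ord0 j).
move: v0; rewrite mxE/= ltr_norml => /andP[h1 h2].
have vj' j : (`|v ord0 (lift ord0 j)| < 1 / 8)%R by have := vj j; rewrite mxE/= subr0.
split => [|j|].
- by apply/andP; split; lra.
- by have := vj' j; lra.
- by have := vj' ord0; rewrite /idx1; lra.
Qed.

Lemma width_norm_le1 (v : 'rV[R]_e.+2) : (L : set _) v -> (`|width (v ord0 ord0)| <= 1)%R.
Proof.
move=> [/andP[v0 v1] _ _]; rewrite ger0_norm; first by rewrite /width ge_min lexx.
by rewrite /width le_min ler01/=; lra.
Qed.

Local Notation EK := (\int[PK]_x main_pow x).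

Lemma integral_large_lt : 0 < \int[PK]_x main_pow x -> \int[PK]_x main_pow x < +oo ->
  (0 < k)%N ->
  \int[PL]_x main_pow x < \int[PK]_x main_pow x.
Proof.
move=> EK0 EKoo k0.
(* The relative loss on [G], so that [f] is (3/4)^k on [G] and 1 elsewhere; it is positive because k
   > 0. *)
pose c : R := (1 - (3 / 4) ^+ k)%R.
have c_gt0 : (0 < c)%R.
  by rewrite subr_gt0 exprn_ilt1 ?gtn_eqF//; lra.
have c_le1 : (c <= 1)%R by rewrite /c gerBl exprn_ge0//; lra.
pose f (u : T) : R := (1 - c * \1_G u)%R.
have f0 u : (0 <= f u)%R.
  by rewrite /f indicE; case: (_ \in _); rewrite ?mulr1 ?mulr0 subr_ge0.
have mf : measurable_fun [set: T] f.
  by apply: measurable_funB => //; apply: measurable_funM.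
have le1 : \int[PL]_x main_pow x <= EK * \int[PL]_u (f u)%:E.
  have scaleE : \int[PL]_u (EK * (f u)%:E) = EK * \int[PL]_u (f u)%:E.
    apply: ge0_integralZl; [exact: measurableT|by apply/measurable_EFinP| |exact: ltW].
    by move=> u _; rewrite lee_fin; exact: f0.
  rewrite -scaleE [leLHS]integral_large_resample.
  (* The comparison holds only almost everywhere: [width] is unbounded below, and the bound by 1
     needs heights in the large body. *)
  apply: ae_ge0_le_integral.
  - exact: measurableT.
  - by move=> u _; apply: integral_ge0 => v _; exact: mp0.
  - by apply: (measurable_fun_fubini_tonelli_F (fun p : T * T => main_pow
      (resample_tuple p))) => [|p];
      [exact: (measurableT_comp mmp (@measurable_resample_tuple R e m))|exact: mp0].
  - by move=> u _; apply: mule_ge0; [exact: ltW|rewrite lee_fin; exact: f0].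
  - by apply: emeasurable_funM; [exact: measurable_cst|apply/measurable_EFinP].
  apply: filterS (ae_power_uniform_body L m.+2) => u Lu _.
  have [uG|uG] := boolP (u \in G).
    have -> : f u = ((3 / 4) ^+ k)%R by rewrite /f indicE uG mulr1 /c opprB addrCA
        subrr addr0.
    rewrite [leRHS]muleC; apply: integral_resample_le => i.
    have := set_mem uG i ord0; rewrite mxE/= ltr_norml => /andP[h1 h2].
    have [/andP[v0 v1] _ _] := Lu i.
    rewrite ger0_norm; last by rewrite /width le_min ler01/=; lra.
    by rewrite /width ge_min; apply/orP; right; lra.
  have -> : f u = (1 ^+ k)%R by rewrite /f indicE (negbTE uG) mulr0 subr0 expr1n.
  by rewrite [leRHS]muleC; apply: integral_resample_le => i; exact: width_norm_le1.
apply: (le_lt_trans le1).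
have IG : \int[PL]_u (\1_G u)%:E = PL G.
  by rewrite integral_indic; [rewrite setIT|exact: measurableT|exact: mG].
(* Stated additively to avoid a subtraction of extended reals; positivity of [PL G] then puts the
   mean of [f] below 1. *)
have fG : \int[PL]_u (f u)%:E + c%:E * PL G = 1.
  transitivity (\int[PL]_u ((f u)%:E + c%:E * (\1_G u)%:E)).
    rewrite ge0_integralD//; last 4 first.
    - by move=> u _; rewrite lee_fin.
    - by apply/measurable_EFinP.
    - by move=> u _; rewrite mule_ge0// lee_fin ltW.
    - by apply: emeasurable_funM => //; apply/measurable_EFinP; exact: measurable_indic.
    congr (_ + _); rewrite ge0_integralZl//; last 2 first.
    - by apply/measurable_EFinP; exact: measurable_indic.
    - by rewrite lee_fin ltW.
    by rewrite IG.
  rewrite (eq_integral (cst 1)); last by move=> u _; rewrite /f -EFinM -EFinD subrK.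
  by rewrite integral_cst// mul1e; exact: probability_setT.
have flt1 : \int[PL]_u (f u)%:E < 1.
  rewrite -fG; set I := integral _ _ _.
  have Ifin : I \is a fin_num.
    rewrite ge0_fin_numE; last by apply: integral_ge0 => u _; rewrite lee_fin.
    apply: (@le_lt_trans _ _ 1); last exact: ltry.
    by rewrite -fG leeDl// mule_ge0// lee_fin ltW.
  by rewrite lteDl// mule_gt0.
by rewrite -[ltRHS]mule1 lte_pmul2l// ge0_fin_numE// ltW.
Qed.

End small_large_comparison.

(** * The limit moment on the small body, and the passage to the limit *)

Section main_moment.
Local Open Scope ereal_scope.
Context {R : realType} (e m k : nat) (hm : (m < e.+1)%N).
Local Notation K := (@small_body R e).
Local Notation L := (@large_body R e).
Local Notation T := (m.+2.-tuple 'rV[R]_e.+2).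
Local Notation PK := (power_measure (uniform_body K) m.+2).
Local Notation main_pow := (@main_pow R e m k).

Let mmp := @measurable_main_pow R e m k hm.
Let mp0 := @main_pow_ge0 R e m k.

(** The orthogonal projector onto the main coordinates; it is singular, as it kills the height. *)
Definition main_gram : 'M[R]_e.+2 := main_mx e m *m (main_mx e m)^T.

Lemma main_gramE :
  main_gram = diag_mx (\row_(i < e.+2) ((0 < i <= m.+1)%N)%:R)%R.
Proof.
apply/matrixP => i l; rewrite !mxE.
under eq_bigr do rewrite !mxE.
have [im|im] := boolP (0 < i <= m.+1)%N; last first.
  rewrite mul0rn big1// => j _; case: eqP => [ij|_]; last by rewrite mul0r.
  by move: im; rewrite ij/= ltnS -ltnS ltn_ord.
have ilt : (i.-1 < m.+1)%N by case: (i : nat) im => // i' /andP[].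
have iS : i.-1.+1 = i :> nat by rewrite prednK//; case/andP: im.
rewrite (bigD1 (Ordinal ilt))//= big1 ?addr0 => [|j ji].
  by rewrite iS eqxx mul1r eq_sym.
case: eqP => [ij|_]; last by rewrite mul0r.
by move: ji; rewrite -(inj_eq val_inj)/= ij eqxx.
Qed.

(** The projected edge matrix is square, so its Gram determinant is a square and the root is the
    absolute value of [main_det]. *)
Lemma gram_moment_main (x : T) :
  (gram_moment k main_gram x)%:E = ((unit_simplex_volume m.+1 ^+ k)%R : R)%:E * main_pow x.
Proof.
rewrite /main_pow -EFinM -exprMn; congr ((_ * _) ^+ k)%:E.
rewrite /gram /main_gram mulmxA -mulmxA -trmx_mul det_mulmx det_tr -expr2.
by rewrite sqrtr_sqr.
Qed.

Lemma entry_main_gram i j : (`|main_gram i j| <= 1)%R.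
Proof.
rewrite main_gramE !mxE; case: (i == j); rewrite ?mulr0n ?normr0// mulr1n.
by case: (0 < i <= m.+1)%N; rewrite ?normr1 ?normr0.
Qed.

Lemma integral_main_pow_lty : \int[PK]_x main_pow x < +oo.
Proof.
have [C CP] := @gram_moment_bounded R e.+2 m.+1 k K.
have c0 : (0 < unit_simplex_volume m.+1 ^+ k :> R)%R.
  by rewrite exprn_gt0// unit_simplex_volume_gt0.
(* [C] comes without a sign, and the comparison of integrals asks for a nonnegative bound. *)
pose B : R := Num.max 0%R (C / unit_simplex_volume m.+1 ^+ k)%R.
apply: (@le_lt_trans _ _ (\int[PK]_x (cst B%:E) x)); last first.
  by rewrite integral_cst// [X in _ * X](probability_setT PK) mule1 ltry.
apply: ae_ge0_le_integral => //.
- by move=> x _; rewrite lee_fin le_max lexx.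
apply: filterS (ae_power_uniform_body K m.+2) => x Kx _.
rewrite lee_fin le_max ler_pdivlMr//; apply/orP; right.
rewrite -lee_fin EFinM muleC -gram_moment_main lee_fin; apply: CP => //.
exact: entry_main_gram.
Qed.

(** Moving two vertices by [delta] changes an edge entry by at most 2 [delta]; the m + 1 entries of
    a column change by at most 1/4 in total. *)
Let delta : R := (8 * m.+1%:R)^-1%R.

(** All centers have height 1/2, and center i >= 1 is displaced by 1/2 along coordinate i: the
    projected edges form half the identity matrix. *)
Let center (i : 'I_m.+2) : 'rV[R]_e.+2 :=
  \row_l (if l == ord0 then 1 / 2 else if (l == i :> nat) then 1 / 2 else 0)%R.

Let delta_gt0 : (0 < delta)%R.
Proof. by rewrite invr_gt0 mulr_gt0// ltr0n. Qed.

Let delta_le : (delta * m.+1%:R = 1 / 8)%R.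
Proof.
have : (m.+1%:R != 0 :> R)%R by rewrite pnatr_eq0.
by rewrite /delta; move: (m.+1%:R)%R => z z0; field.
Qed.

Let delta_le8 : (delta <= 1 / 8)%R.
Proof. by rewrite -delta_le ler_peMr ?(ltW delta_gt0)// ler1n. Qed.

(* The matrix of edges is within 1 / 4 of half the identity in the row-sum norm. *)
Lemma main_det_neq0 (x : T) : (forall i, open_box (center i) delta (tnth x i)) ->
  main_det x != 0%R.
Proof.
move=> xc; apply/negP => /det0P[v v0 vN].
have NE i j : (`|main_edges x i j - (if i == j then 1 / 2 else 0)| <= 2 * delta)%R.
  rewrite (main_edgesE hm).
  have h1 := xc (lift ord0 i) (main_idx hm j).
  have h2 := xc ord0 (main_idx hm j).
  move: h1 h2; rewrite /center !mxE.
  rewrite (_ : (main_idx hm j == lift ord0 i :> nat) = (i == j)); last first.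
    by rewrite /= /bump/= !add1n eqSS eq_sym.
  rewrite (_ : (main_idx hm j == @ord0 m.+1 :> nat) = false)//=.
  case: eqP => _; rewrite !ltr_norml => /andP[a1 a2] /andP[b1 b2];
    by apply/ler_normlP; split; lra.
(* Diagonal dominance: in the column of the largest entry of the null vector [v], half that entry
   would be balanced by at most a quarter of it. *)
pose i0 := [arg max_(i > ord0) `|v ord0 i|%R]%O.
have vmax i : (`|v ord0 i| <= `|v ord0 i0|)%R.
  by rewrite /i0; case: arg_maxP => // i1 _; exact.
have /rowP/(_ i0) := vN; rewrite !mxE.
set t := fun i => (main_edges x i i0 - (if i == i0 then 1 / 2 else 0))%R.
have -> : (\sum_i v ord0 i * main_edges x i i0 =
    v ord0 i0 / 2 + \sum_i v ord0 i * t i)%R.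
  rewrite -[X in (X + _)%R](_ : \sum_i v ord0 i * (if i == i0 then 1 / 2 else 0) = _)%R.
    by rewrite -big_split/=; apply: eq_bigr => i _; rewrite /t -mulrDr addrC subrK.
  rewrite (bigD1 i0)//= eqxx big1 ?addr0 ?div1r// => i ii0.
  by rewrite (negbTE ii0) mulr0.
move=> /eqP; rewrite addr_eq0 => /eqP vE.
have : (`|v ord0 i0 / 2| <= `|v ord0 i0| * (2 * delta) * m.+1%:R)%R.
  rewrite [leRHS]mulr_natr vE normrN -[X in (_ *+ X)%R](card_ord m.+1) -sumr_const.
  apply: (le_trans (ler_norm_sum _ _ _)); apply: ler_sum => i _.
  by rewrite normrM ler_pM// NE.
rewrite normrM normfV (ger0_norm (ler0n _ 2)).
rewrite (_ : `|v ord0 i0| * (2 * delta) * m.+1%:R = `|v ord0 i0| * 2 * (delta *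
    m.+1%:R))%R; last by ring.
rewrite delta_le => h; have : (`|v ord0 i0| <= 0)%R by lra.
move=> vi0; move: v0; apply/negP; rewrite negbK; apply/eqP/rowP => i; rewrite mxE.
by apply/eqP; rewrite -normr_le0 (le_trans (vmax i)).
Qed.

(** Otherwise the determinant power vanishes almost everywhere, although it is nonzero on a product
    of boxes of positive probability. *)
Lemma integral_main_pow_gt0 : 0 < \int[PK]_x main_pow x.
Proof.
rewrite lt_neqAle eq_sym integral_ge0// andbT; apply/eqP => E0.
pose G : set T := [set x | forall i, open_box (center i) delta (tnth x i)].
have mG : measurable G.
  by apply: (@measurable_tuple_box _ _ _ (fun i => open_box (center i) delta)) => i;
      exact: measurable_open_box.
have PG : 0 < PK G.
  have /= := @power_measure_box _ _ _ (uniform_body K) m.+2 (fun i => open_box (center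
      i) delta).
  rewrite /G => -> => [|i]; last exact: measurable_open_box.
  elim/big_ind : _ => // [x y|i _]; first exact: mule_gt0.
  apply: uniform_open_box_gt0 => // v vb.
  have d8 : (delta <= 1 / 8)%R := delta_le8.
  have := vb ord0; rewrite !mxE/= ltr_norml => /andP[h1 h2].
  split; first by apply/andP; split; lra.
  move=> j; have := vb (lift ord0 j); rewrite !mxE/=.
  by case: eqP => _; rewrite ltr_norml => /andP[h3 h4]; apply/ler_normlP; split; lra.
have : \int[PK]_x `|main_pow x| = 0.
  by rewrite -[RHS]E0; apply: eq_integral => x _; rewrite gee0_abs.
move=> /(ae_eq_integral_abs PK measurableT mmp)[N [mN N0 GN]].
have : PK G <= PK N.
  apply: le_measure; rewrite ?inE// => x Gx; apply: GN => /= /(_ Logic.I) /eqP.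
  by rewrite eqe expf_eq0 normr_eq0 (negbTE (main_det_neq0 Gx)) andbF.
by rewrite N0 leNgt PG.
Qed.

Definition flat_mx (s : R) : 'M[R]_e.+2 :=
  diag_mx (\row_(i < e.+2) (if (0 < i <= m.+1)%N then 1 else s))%R.

Lemma flat_mx_unit s : s != 0%R -> flat_mx s \in unitmx.
Proof.
move=> s0; rewrite unitmxE unitfE det_diag; apply/prodf_neq0 => i _.
by rewrite mxE; case: ifP; rewrite ?oner_neq0.
Qed.

Lemma flat_gramE s i j : ((flat_mx s *m (flat_mx s)^T) i j =
  (if (0 < i <= m.+1)%N then 1 else s ^+ 2) *+ (i == j))%R.
Proof.
rewrite tr_diag_mx mulmx_diag !mxE; congr (_ *+ _)%R.
by case: ifP; rewrite ?mulr1// expr2.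
Qed.

(** Tends to 0 without vanishing, so every flattening is invertible and yields a convex body. *)
Let s_ (l : nat) : R := l.+1%:R^-1%R.

Let s_neq0 l : s_ l != 0%R.
Proof. by rewrite invr_neq0// pnatr_eq0. Qed.

(** The Gram matrix of the flattening is diagonal with entries 1 and the square of [s_ l], hence
    converges to [main_gram]. *)
Lemma cvg_volume_moment_flat (B : convex_body R e.+2) :
  volume_moment (linear_image B (flat_mx_unit (s_neq0 l))) m.+2 k @[l --> \oo] -->
  ((unit_simplex_volume m.+1 ^+ k)%R : R)%:E *
    \int[power_measure (uniform_body B) m.+2]_x main_pow x.
Proof.
have -> : (fun l => volume_moment (linear_image B (flat_mx_unit (s_neq0 l))) m.+2 k) =
    (fun l => \int[power_measure (uniform_body B) m.+2]_x
      (gram_moment k (flat_mx (s_ l) *m (flat_mx (s_ l))^T) x)%:E).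
  by apply/funext => l; apply: volume_moment_linear_image; exact: leqW.
have -> : ((unit_simplex_volume m.+1 ^+ k)%R : R)%:E *
    \int[power_measure (uniform_body B) m.+2]_x main_pow x =
    \int[power_measure (uniform_body B) m.+2]_x (gram_moment k main_gram x)%:E.
  rewrite -ge0_integralZl; [|exact: measurableT|exact: mmp|by move=> x _; exact: mp0|].
    by apply: eq_integral => x _; rewrite gram_moment_main.
  by rewrite lee_fin exprn_ge0// ltW// unit_simplex_volume_gt0.
apply: cvg_gram_moment => [i j|l i j].
  under eq_fun do rewrite flat_gramE.
  rewrite main_gramE !mxE.
  case: (0 < i <= m.+1)%N; first exact: cvg_cst.
  case: eqP => _; rewrite ?mulr1n ?mulr0n; last exact: cvg_cst.
  have := cvgM (@cvg_harmonic R) (@cvg_harmonic R); rewrite mulr0.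
  by apply.
rewrite flat_gramE normrMn; case: (i == j); rewrite ?mulr0n// mulr1n.
case: ifP => _; first by rewrite normr1.
rewrite normrX expr_le1// ger0_norm ?invr_ge0//.
by rewrite invf_le1// ler1n.
Qed.

Lemma volume_moment_decreases : (0 < k)%N -> exists A B : convex_body R e.+2,
  (A : set 'rV[R]_e.+2) `<=` B /\ volume_moment B m.+2 k < volume_moment A m.+2 k.
Proof.
move=> k0; pose A l := linear_image K (flat_mx_unit (s_neq0 l)).
pose B l := linear_image L (flat_mx_unit (s_neq0 l)).
have AB l : (A l : set 'rV[R]_e.+2) `<=` B l.
  by move=> _ [v Kv <-]; exists v => //; exact: small_large.
have cA := @cvg_volume_moment_flat K; have cB := @cvg_volume_moment_flat L.
suff [l Hl] : exists l, volume_moment (B l) m.+2 k < volume_moment (A l) m.+2 k.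
  by exists (A l), (B l).
(* If no flattening worked, the reverse inequality would pass to the limit and contradict the strict
   one there. *)
apply: contrapT => /forallNP H.
have H' l : volume_moment (A l) m.+2 k <= volume_moment (B l) m.+2 k.
  by rewrite leNgt; apply/negP; exact: H.
have : limn (fun l => volume_moment (A l) m.+2 k) <= limn (fun l => volume_moment (B l)
    m.+2 k).
  apply: lee_lim; [by apply/cvg_ex; eexists; exact: cA|by apply/cvg_ex; eexists;
      exact: cB|].
  exact: nearW.
have limA := cvg_lim (@ereal_hausdorff R) cA.
have limB := cvg_lim (@ereal_hausdorff R) cB.
rewrite [leLHS]limA [leRHS]limB leNgt => /negP; apply.
have c0 : 0 < ((unit_simplex_volume m.+1 ^+ k)%R : R)%:E.
  by rewrite lte_fin exprn_gt0// unit_simplex_volume_gt0.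
rewrite lte_pmul2l; [|by []|exact: c0].
apply: integral_large_lt; [exact: hm|exact: integral_main_pow_gt0|
    exact: integral_main_pow_lty|exact: k0].
Qed.

End main_moment.

Local Open Scope ereal_scope.

Theorem theorem2 (R : realType) (d n k : nat) (hd : (2 <= d)%N)
    (hn : (2 <= n <= d)%N) (hk : (0 < k)%N) :
  exists K L : convex_body R d,
    (K : set 'rV[R]_d) `<=` L /\ volume_moment L n k < volume_moment K n k.
Proof.
(* With d = e + 2 and n = m + 2, n <= d becomes [m < e.+1]: the m + 1 main coordinates fit beside
   the height. *)
move: d n hd hn => [|[|e]]// [|[|m]]// _ /= hm.
exact: (@volume_moment_decreases R e m k hm).
Qed.
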